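(* Let $(\mathbb S,\mathbf d)$ be a metric space, let $\{\{V^\eta_j(x):j\ge0\}:\eta>0\}$ be a family of $\mathbb S$-valued Markov chains (where $x\in\mathbb S$ is the initial state and $j$ the time index), and let $I\subseteq\mathbb S$. Suppose the family possesses an asymptotic atom $\{A(\epsilon)\subseteq\mathbb S:\epsilon>0\}$ associated with the domain $I$, location measure $C(\cdot)$, scale $\gamma:(0,\infty)\to(0,\infty)$, and covering $\{I(\epsilon)\subseteq I:\epsilon>0\}$. Then the first exit time $\tau^\eta_{I^c}(x)$ scales as $1/\gamma(\eta)$, and the distribution of the location $V^\eta_\tau(x)$ at the first exit time converges to $C(\cdot)$; moreover, the convergence is uniform over $I(\epsilon)$ for any $\epsilon>0$. That is: (i) If $C(I^c)=1$, then for each $\epsilon>0$, measurable $B\subseteq I^c$, and $t\ge0$, $$C(B^\circ)\cdot e^{-t}\le\liminf_{\eta\downarrow0}\inf_{x\in I(\epsilon)}\mathbf P\big(\gamma(\eta)\tau^\eta_{I^c}(x)>t,\ V^\eta_\tau(x)\in B\big)\le\limsup_{\eta\downarrow0}\sup_{x\in I(\epsilon)}\mathbf P\big(\gamma(\eta)\tau^\eta_{I^c}(x)>t,\ V^\eta_\tau(x)\in B\big)\le C(B^-)\cdot e^{-t}.$$ (ii) If $C(I^c)=0$, then for each $\epsilon,t>0$, $$\lim_{\eta\downarrow0}\sup_{x\in I(\epsilon)}\mathbf P\big(\gamma(\eta)\tau^\eta_{I^c}(x)\le t\big)=0.$$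
   Context: For $E\subseteq\mathbb S$, $\tau^\eta_E(x)=\min\{j\ge0:V^\eta_j(x)\in E\}$ is the first hitting time of $E$; $V^\eta_\tau(x)=V^\eta_{\tau^\eta_{I^c}(x)}(x)$ and $V^\eta_{\tau_\epsilon}(x)=V^\eta_{\tau^\eta_{I(\epsilon)^c}(x)}(x)$. $B^\circ$ and $B^-$ are the interior and closure of $B$, and $E^c$ is the complement of $E$ in $\mathbb S$. Setting. $I\subseteq\mathbb S$ is an asymptotic domain of attraction, within which the scaled process $\{V^\eta_{\lfloor t/\eta\rfloor}(x):t\in[0,T]\}$ typically (i.e., as $\eta\downarrow0$) stays throughout any fixed time horizon $[0,T]$ as long as the initial state $x$ is in $I$. $\{I(\epsilon):\epsilon>0\}$ and $\{A(\epsilon):\epsilon>0\}$ are collections of subsets of $I$ such that $\bigcup_{\epsilon>0}I(\epsilon)=I$ and $\bigcap_{\epsilon>0}A(\epsilon)\ne\emptyset$. $C(\cdot)$ is a Borel measure on $\mathbb S\setminus I$ satisfying $C(\partial I)=0$, regarded as a measure on $\mathbb S$ supported on $I^c$ (so $C(B)=C(B\setminus I)$). Two cases are considered: $C(I^c)\in(0,\infty)$, in which case, by absorbing the normalizing constant into $\gamma$, $C$ is taken without loss of generality to be a probability measure, $C(I^c)=1$; or $C(I^c)=0$, i.e. $C$ is trivially zero. Asymptotic atom. The family $\{\{V^\eta_j(x):j\ge0\}:\eta>0\}$ possesses an asymptotic atom $\{A(\epsilon):\epsilon>0\}$ associated with the domain $I$, location measure $C(\cdot)$, scale $\gamma:(0,\infty)\to(0,\infty)$,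 and covering $\{I(\epsilon):\epsilon>0\}$ if the following holds: for each measurable $B\subseteq\mathbb S$ there exist $\delta_B:(0,\infty)\times(0,\infty)\to(0,\infty)$, $\epsilon_B>0$, and $T_B:(0,\infty)\to(0,\infty)$ such that $$C(B^\circ)-\delta_B(\epsilon,T)\le\liminf_{\eta\downarrow0}\frac{\inf_{x\in A(\epsilon)}\mathbf P\big(\tau^\eta_{I(\epsilon)^c}(x)\le T/\eta;\ V^\eta_{\tau_\epsilon}(x)\in B\big)}{\gamma(\eta)T/\eta}$$ $$\le\limsup_{\eta\downarrow0}\frac{\sup_{x\in A(\epsilon)}\mathbf P\big(\tau^\eta_{I(\epsilon)^c}(x)\le T/\eta;\ V^\eta_{\tau_\epsilon}(x)\in B\big)}{\gamma(\eta)T/\eta}\le C(B^-)+\delta_B(\epsilon,T),$$ $$\limsup_{\eta\downarrow0}\frac{\sup_{x\in I(\epsilon)}\mathbf P\big(\tau^\eta_{(I(\epsilon)\setminus A(\epsilon))^c}(x)>T/\eta\big)}{\gamma(\eta)T/\eta}=0,$$ $$\liminf_{\eta\downarrow0}\ \inf_{x\in I(\epsilon)}\mathbf P\big(\tau^\eta_{A(\epsilon)}(x)\le T/\eta\big)=1$$ for any $\epsilon\le\epsilon_B$ and $T\ge T_B(\epsilon)$, where $\gamma(\eta)/\eta\to0$ as $\eta\downarrow0$ and the $\delta_B$'s are such that $\lim_{\epsilon\downarrow0}\lim_{T\to\infty}\delta_B(\epsilon,T)=0$.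
   Formalization: Two hypotheses are added, as the claim fails without them: the chain stays in I over any horizon [0,T] with probability tending to 1 uniformly over each I(ε), and each I(ε) is contained in I(ε') for all small ε'. Chains are time-homogeneous; I, I(ε), A(ε) are Borel. *)

(* Defs.v *)
From HB Require Import structures.
From mathcomp Require Import all_boot all_order all_algebra.
From mathcomp Require Import all_classical all_reals all_analysis.
Import Order.TTheory GRing.Theory Num.Theory.
Import numFieldNormedType.Exports.

Set Implicit Arguments.
Unset Strict Implicit.
Unset Printing Implicit Defensive.

Local Open Scope classical_set_scope.
Local Open Scope ring_scope.
Local Open Scope ereal_scope.

(* Nonempty metric spaces: [measurableType] requires a point. The chosen point
   plays no role. *)
#[short(type="pmetricType")]
HB.structure Definition PointedMetric (R : numDomainType) :=
  { T of Pointed T & Metric R T }.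

Notation Borel S := (g_sigma_algebraType (@open S)).

Section markov_chain.
Context {R : realType} {S : pmetricType R} {d : measure_display}
  {Omega : measurableType d}.

Implicit Types X : nat -> Omega -> S.

(* The sigma-algebra generated by X_0, ..., X_n *)
Definition history X (n : nat) : set (set Omega) :=
  <<s \bigcup_(j in [set j | (j <= n)%N])
        preimage_set_system setT (X j) (@measurable _ (Borel S)) >>.

(* The last clause is P(X_{n+1} \in B | X_0, ..., X_n) = K(X_n, B) almost
   surely, written out as the defining property of conditional probability. *)
Definition markov_chain (P : probability Omega R)
    (K : R.-pker (Borel S) ~> (Borel S)) (x : S) X :=
  [/\ forall j, measurable_fun setT (X j : Omega -> Borel S),
      forall w, X 0%N w = x
    & forall (n : nat) (H : set Omega) (B : set (Borel S)),
        history X n H -> measurable B ->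
        P (H `&` X n.+1 @^-1` B) = \int[P]_(w in H) K (X n w) B].

(* V eta j x is the state at time j of the chain with parameter eta started
   at x; only eta > 0 matters. The chains are time-homogeneous: the kernel
   depends neither on the initial state nor on the time. *)
Definition markov_family (P : probability Omega R)
    (V : R -> nat -> S -> Omega -> S) :=
  forall eta : R, (0 < eta)%R ->
    exists K : R.-pker (Borel S) ~> (Borel S),
      forall x, markov_chain P K x (fun j => V eta j x).

(* Equal to +oo when E is never visited *)
Definition hitting_time X (E : set S) (w : Omega) : \bar R :=
  ereal_inf [set j%:R%:E | j in [set j | E (X j w)]].

(* The event { X_tau \in B } for tau the hitting time of E; X_tau is left
   undefined on { tau = +oo }, which is therefore excluded. *)
Definition hit_location_in X (E B : set S) : set Omega :=
  [set w | exists2 j : nat, hitting_time X E w = j%:R%:E & B (X j w)].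

End markov_chain.

Section asymptotic_atom.
Context {R : realType} {S : pmetricType R} {d : measure_display}
  {Omega : measurableType d}.
Variables (P : probability Omega R) (V : R -> nat -> S -> Omega -> S).

Local Notation tau eta E x := (hitting_time (fun j => V eta j x) E).
Local Notation located eta E x B := (hit_location_in (fun j => V eta j x) E B).

(* C is a measure on the complement of I, extended by 0 to S. *)
Definition location_measure (I : set S)
    (C : {measure set (Borel S) -> \bar R}) :=
  C I = 0 /\ C (closure I `\` interior I) = 0.

Definition covering (I : set S) (Icov : R -> set S) :=
  [/\ forall e : R, (0 < e)%R ->
        measurable (Icov e : set (Borel S)) /\ Icov e `<=` I,
      \bigcup_(e in [set e : R | (0 < e)%R]) Icov e = I
    & forall e : R, (0 < e)%R ->
        \forall e' \near (0%R : R)^'+, Icov e `<=` Icov e'].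

(* The scaled process stays in I over any fixed time horizon [0, T] with
   probability tending to 1, uniformly over each member of the covering.
   It is [1 <= _] and not [_ = 1] because the infimum is +oo when Icov e is
   empty. *)
Definition asymptotic_domain_of_attraction (I : set S) (Icov : R -> set S) :=
  forall e T : R, (0 < e)%R -> (0 < T)%R ->
    1 <= limf_einf (fun eta : R =>
           ereal_inf [set P [set w | forall t : R, (0 <= t <= T)%R ->
                                I (V eta (Num.truncn (t / eta)) x w)]
                     | x in Icov e])
         (0%R : R)^'+.

(* The iterated limit lim_(e -> 0+) lim_(T -> +oo) delta e T is 0. *)
Definition iterated_lim0 (delta : R -> R -> R) :=
  (\forall e \near (0%R : R)^'+, cvg (delta e T @[T --> +oo%R])) /\
  (lim (delta e T @[T --> +oo%R]) : R) @[e --> (0%R : R)^'+] --> (0%R : R).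

Definition asymptotic_atom (I : set S) (C : {measure set (Borel S) -> \bar R})
    (gamma : R -> R) (Icov A : R -> set S) :=
  [/\ [/\ forall e : R, (0 < e)%R ->
            measurable (A e : set (Borel S)) /\ A e `<=` I
        & \bigcap_(e in [set e : R | (0 < e)%R]) A e !=set0],
      forall eta : R, (0 < eta)%R -> (0 < gamma eta)%R,
      (gamma eta / eta)%R @[eta --> (0%R : R)^'+] --> (0%R : R)
    & forall B : set (Borel S), measurable B ->
      exists (delta : R -> R -> R) (eB : R) (TB : R -> R),
      [/\ forall e T : R, (0 < e)%R -> (0 < T)%R -> (0 < delta e T)%R,
          (0 < eB)%R,
          forall e : R, (0 < e)%R -> (0 < TB e)%R,
          iterated_lim0 delta
        & forall e T : R, (0 < e)%R -> (e <= eB)%R -> (TB e <= T)%R ->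
          let exit_in eta x :=
            P ([set w | tau eta (~` Icov e) x w <= (T / eta)%:E] `&`
               located eta (~` Icov e) x B) in
          let norm eta : \bar R := (gamma eta * T / eta)%:E in
          [/\ [/\ C (interior B) - (delta e T)%:E <=
                    limf_einf (fun eta : R =>
                      ereal_inf [set exit_in eta x | x in A e] / norm eta)
                      (0%R : R)^'+,
                  limf_einf (fun eta : R =>
                    ereal_inf [set exit_in eta x | x in A e] / norm eta)
                    (0%R : R)^'+ <=
                    limf_esup (fun eta : R =>
                      ereal_sup [set exit_in eta x | x in A e] / norm eta)
                      (0%R : R)^'+
                & limf_esup (fun eta : R =>
                    ereal_sup [set exit_in eta x | x in A e] / norm eta)
                    (0%R : R)^'+ <=
                    C (closure B) + (delta e T)%:E],
              limf_esup (fun eta : R =>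
                ereal_sup [set P [set w |
                    (T / eta)%:E < tau eta (~` (Icov e `\` A e)) x w]
                  | x in Icov e] / norm eta) (0%R : R)^'+ = 0
            & limf_einf (fun eta : R =>
                ereal_inf [set P [set w | tau eta (A e) x w <= (T / eta)%:E]
                  | x in Icov e]) (0%R : R)^'+ = 1]]].

End asymptotic_atom.

(* Main.v *)
(* Cut time into cycles: start in A(eps), run T/eta steps, then wait until the
   chain is back in A(eps). Write rho = gamma(eta) T / eta. By the atom property
   with B, the whole space and I, a cycle leaves I(eps) into B with probability
   about rho C(B), leaves I(eps) at all with probability about rho C(S), and
   lands in I \ I(eps) with negligible probability. The waiting phase lasts at
   most T0/eta steps with T0 << T, so the probability of leaving during it is
   bounded by the difference of the exit probabilities at the horizons T + T0
   and T, hence is small compared with rho. The strong Markov property at the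
   end of one cycle then gives inequalities
       g(m) <= small rho + (1 - rho a) g(m - L),  h(m) >= (1 - rho th) h(m - l)
   for the supremum g and the infimum h over A(eps) of the probability that the
   chain exits I after time m and into B; the values at m = 0 come from the same
   inequalities read as fixpoint inequalities. Iterating t / rho times yields
   C(B) exp(- t). Starting points in I(e) are handled by choosing eps with
   I(e) included in I(eps) and waiting for the first visit to A(eps), which by
   asymptotic attraction happens before I is left. *)

Require Import Defs.
From HB Require Import structures.
From mathcomp Require Import all_boot all_order all_algebra.
From mathcomp Require Import all_classical all_reals all_analysis.
From mathcomp Require Import measurable_realfun zify lra ring.
Import Order.TTheory GRing.Theory Num.Theory.
Import numFieldNormedType.Exports.

Set Implicit Arguments.
Unset Strict Implicit.
Unset Printing Implicit Defensive.

Local Open Scope classical_set_scope.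
Local Open Scope ring_scope.
Local Open Scope ereal_scope.

(** * Integration against kernels *)

Section mixture.
Context {R : realType} {d d' : measure_display}
  {Y : measurableType d} {Z : measurableType d'}.
Variables (mu : {measure set Y -> \bar R}) (D : set Y).
Hypothesis mD : measurable D.
Implicit Types k : Y -> {measure set Z -> \bar R}.

Import HBNNSimple.

(** The right-hand side sees [k] only through the mixtures [\int[mu]_(y in D) k y E], which allows
    two kernels to be compared on sets alone. *)
Lemma ge0_integral_kernel_nnsfun k (f : {nnsfun Z >-> R}) :
  (forall E : set Z, measurable E -> measurable_fun setT (k ^~ E : Y -> \bar R)) ->
  \int[mu]_(y in D) \int[k y]_z (f z)%:E =
  \sum_(r \in range f) (r%:E * \int[mu]_(y in D) k y (f @^-1` [set r])).
Proof.
move=> mk; have mkr r : measurable_fun D (fun y => k y (f @^-1` [set r])).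
  by apply: (measurable_funS measurableT) => //; exact: mk.
under eq_integral do rewrite integralT_nnsfun sintegralE.
rewrite ge0_integral_fsum//=; last 2 first.
- by move=> r; apply: measurable_funeM.
- by move=> r y _; exact: nnsfun_mulemu_ge0.
(* [ge0_integralZl] asks for [0 <= r]; a negative [r] has an empty preimage, so both terms
   vanish. *)
apply: eq_fsbigr => r _; have [r0|r0] := leP 0%R r.
  by rewrite ge0_integralZl.
under eq_integral do rewrite preimage_nnfun0// measure0 mule0.
under [in RHS]eq_integral do rewrite preimage_nnfun0// measure0.
by rewrite integral0 mule0.
Qed.

Lemma ge0_integral_kernel_lim k (f : Z -> \bar R) (mf : measurable_fun setT f) :
  (forall E : set Z, measurable E -> measurable_fun setT (k ^~ E : Y -> \bar R)) ->
  (forall z, 0 <= f z) ->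
  \int[mu]_(y in D) \int[k y]_z f z = limn (fun n =>
    \int[mu]_(y in D) \int[k y]_z (nnsfun_approx measurableT mf n z)%:E).
Proof.
move=> mk f0; pose g := nnsfun_approx measurableT mf.
have g0 n z : 0 <= (g n z)%:E by rewrite lee_fin.
have mg n : measurable_fun setT (EFin \o g n) by exact/measurable_EFinP.
have ndg z : {homo (fun n => (g n z)%:E) : m n / (m <= n)%N >-> m <= n}.
  by move=> m n mn; rewrite lee_fin; exact/lefP/nd_nnsfun_approx.
have mono (m : {measure set Z -> \bar R}) :
    \int[m]_z f z = limn (fun n => \int[m]_z (g n z)%:E).
  transitivity (\int[m]_z limn (fun n => (g n z)%:E)).
    by apply: eq_integral => z _; apply/esym/cvg_lim => //; exact: cvg_nnsfun_approx.
  by apply: monotone_convergence => // z _; exact: ndg.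
under eq_integral do rewrite mono.
rewrite monotone_convergence//.
- move=> n; apply: (measurable_funS measurableT) => //.
  exact: (measurable_fun_integral_kernel mk (g0 n) (mg n)).
- by move=> n y _; exact: integral_ge0.
- move=> y _ m n mn; apply: ge0_le_integral => //; first exact: mg.
    exact: mg.
  by move=> z _; exact: ndg.
Qed.

(** Monotone convergence reduces [f] to its simple approximations, whose iterated integrals are
    determined by the mixtures of their level sets. *)
Lemma eq_ge0_integral_kernel k1 k2 (f : Z -> \bar R) :
  (forall E : set Z, measurable E -> measurable_fun setT (k1 ^~ E : Y -> \bar R)) ->
  (forall E : set Z, measurable E -> measurable_fun setT (k2 ^~ E : Y -> \bar R)) ->
  (forall E : set Z, measurable E ->
    \int[mu]_(y in D) k1 y E = \int[mu]_(y in D) k2 y E) ->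
  measurable_fun setT f -> (forall z, 0 <= f z) ->
  \int[mu]_(y in D) \int[k1 y]_z f z = \int[mu]_(y in D) \int[k2 y]_z f z.
Proof.
move=> mk1 mk2 k12 mf f0; rewrite (ge0_integral_kernel_lim mf mk1 f0).
rewrite (ge0_integral_kernel_lim mf mk2 f0).
congr (limn _); apply/funext => n; rewrite !ge0_integral_kernel_nnsfun//.
by apply: eq_fsbigr => r _; rewrite k12.
Qed.

End mixture.

(** * Events on trajectories *)

Section trajectories.
Context {S : Type}.
Implicit Types (D J A B I : set S) (s : nat -> S) (Phi : set (nat -> S)).
Implicit Types i j k l m n : nat.

Definition stay_then D k B : set (nat -> S) :=
  [set s | (forall i, (i < k)%N -> D (s i)) /\ B (s k)].

Definition shifted j Phi : set (nat -> S) :=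
  [set s | Phi (fun i => s (j + i)%N)].

(* The first exit from [J] occurs by time [n], at a point of [B]. *)
Definition exits J n B : set (nat -> S) :=
  [set s | exists2 k, (k <= n)%N & stay_then J k (B `\` J) s].

(* For [B] disjoint from [I]: the first exit from [I] occurs after time [m], at a
   point of [B]. *)
Definition late_hit I m B : set (nat -> S) :=
  [set s | exists2 k, (m < k)%N & stay_then I k B s].

(* First visit to [A] not before time [l], at time [j <= l + n], the chain having
   stayed in [J]: the end of a cycle. With [l = 0] and [J = I] it is the first
   visit to [A] before leaving [I]. *)
Definition regen J A l n j : set (nat -> S) :=
  [set s | [/\ (l <= j <= l + n)%N, forall i, (i <= j)%N -> J (s i),
    forall i, (l <= i < j)%N -> ~ A (s i) & A (s j)]].

Lemma exists_first (Q : nat -> Prop) n : Q n ->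
  exists2 k, (k <= n)%N & (forall i, (i < k)%N -> ~ Q i) /\ Q k.
Proof.
elim/ltn_ind: n => n IH Qn.
have [[i ni Qi]|nQ] := pselect (exists2 i, (i < n)%N & Q i).
  by have [k ki Qk] := IH i ni Qi; exists k => //; exact: leq_trans ki (ltnW ni).
by exists n => //; split => // i ni Qi; apply: nQ; exists i.
Qed.

Lemma stay_or_exit J n s :
  (forall i, (i <= n)%N -> J (s i)) \/ exits J n setT s.
Proof.
have [|/existsNP[i /not_implyP[ni nJ]]] := pselect (forall i, (i <= n)%N -> J (s i)).
  by left.
right; have [k ki [kJ nJk]] := exists_first (Q := fun i => ~ J (s i)) nJ.
exists k; first exact: leq_trans ki ni.
by split => // j /kJ /contrapT.
Qed.

Lemma exits_not_stay J n B s : (forall i, (i <= n)%N -> J (s i)) -> ~ exits J n B s.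
Proof. by move=> sJ [k kn [_ [_]]]; apply; exact: sJ. Qed.

Lemma exits_le J m n B : (m <= n)%N -> exits J m B `<=` exits J n B.
Proof. by move=> mn s [k km ?]; exists k => //; exact: leq_trans mn. Qed.

Lemma exits_split J n B s :
  exits J n setT s -> exits J n B s \/ exits J n (~` B) s.
Proof.
move=> [k kn [kJ [_ nJ]]]; have [sB|sB] := pselect (B (s k)).
  by left; exists k.
by right; exists k.
Qed.

(** [j] is the value of a stopping time, the end of the cycle, so different [j] exclude each other
    and their probabilities can be summed. *)
Lemma regen_disjoint J A l n : trivIset setT (regen J A l n).
Proof.
apply/trivIsetP => j k _ _; wlog jk : j k / (j < k)%N => [H jk|_].
  by move: jk; rewrite neq_ltn => /orP[|] jk; [|rewrite setIC];
    apply: H => //; rewrite neq_ltn jk.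
rewrite -subset0 => s [[/andP[lj _] _ _ Aj] [_ _ nA _]].
by apply: (nA j) => //; rewrite lj.
Qed.

(** The three fates of a cycle: a visit to [A] in the waiting phase, an exit from [J] by its end, or
    a waiting phase spent entirely in [J] away from [A]. Only the first lets the chain start
    afresh. *)
Lemma regen_cover J A l n s :
  [\/ (\bigcup_j regen J A l n j) s, exits J (l + n) setT s |
      J (s l) /\ shifted l (stay_then (J `\` A) n (J `\` A)) s].
Proof.
have [sJ|] := stay_or_exit J (l + n) s; last by constructor 2.
have [[i lin Ai]|nA] := pselect (exists2 i, (l <= i <= l + n)%N & A (s i)).
  constructor 1; have [k ki [kA [lk Ak]]] :=
    exists_first (Q := fun i => (l <= i)%N /\ A (s i)) (conj (proj1 (andP lin)) Ai).
  have kn : (k <= l + n)%N by case/andP: lin => _; exact: leq_trans.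
  exists k => //; split => //; first by rewrite lk.
    by move=> j jk; apply: sJ; exact: leq_trans kn.
  by move=> j /andP[lj jk] Aj; exact: (kA j jk).
have st i : (i <= n)%N -> (J `\` A) (s (l + i)%N).
  move=> ni; split; first by apply: sJ; rewrite leq_add2l.
  by move=> Ai; apply: nA; exists (l + i)%N => //; rewrite leq_addr leq_add2l.
constructor 3; split; first by apply: sJ; rewrite leq_addr.
by split => [i /ltnW|]; exact: st.
Qed.

Lemma regen_not_exits J A l n j B s : regen J A l n j s -> ~ exits J l B s.
Proof.
move=> [/andP[lj _] jJ _ _]; apply: exits_not_stay => i il; apply: jJ.
exact: leq_trans lj.
Qed.

Section domain.
Variables (I J A B : set S).
Hypotheses (JI : J `<=` I) (BI : B `<=` ~` I).

(** A cycle consumes at least [l] and at most [l + n] steps. Upper bounds therefore pass to the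
    threshold [m - (l + n)], and lower bounds to [m - l]; both subtractions are truncated at 0. *)
Lemma late_hit_regen l n j m s : regen J A l n j s -> late_hit I m B s ->
  shifted j (late_hit I (m - (l + n)) B) s.
Proof.
move=> [/andP[_ jn] jJ _ _] [k mk [kI sB]].
(* Up to [j] the chain is in [I], so the visit to [B] comes strictly later; the shifted event
   demands this when [m - (l + n)] is truncated to 0. *)
have jk : (j < k)%N.
  by rewrite ltnNge; apply/negP => kj; apply: (BI sB); exact/JI/jJ.
exists (k - j)%N.
  by move: mk jn jk; clear; lia.
split; last by rewrite subnKC// ltnW.
by move=> i ik; apply: kI; rewrite -ltn_subRL.
Qed.

Lemma regen_late_hit l n j m s : regen J A l n j s ->
  shifted j (late_hit I (m - l) B) s -> late_hit I m B s.
Proof.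
move=> [/andP[lj _] jJ _ _] [k mk [kI sB]].
exists (j + k)%N; first by move: mk lj; clear; lia.
split => // i ik; have [ij|ji] := leqP i j; first exact/JI/jJ.
by rewrite -(subnKC (ltnW ji)); apply: kI; rewrite ltn_subLR// ltnW.
Qed.

Lemma regen_stay l n j m s : regen J A l n j s ->
  shifted j (stay_then I (m - l) I) s -> stay_then I m I s.
Proof.
move=> [/andP[lj _] jJ _ _] [kI sI].
have sI' i : (i <= m)%N -> I (s i).
  move=> im; have [ij|ji] := leqP i j; first exact/JI/jJ.
  have iE : s i = s (j + (i - j))%N by rewrite subnKC// ltnW.
  have [ilt|ige] := ltnP (i - j)%N (m - l)%N; first by rewrite iE; exact: kI.
  have -> : i = (j + (m - l))%N by move: im ji lj ige; clear; lia.
  exact: sI.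
by split => [i /ltnW|]; exact: sI'.
Qed.

Lemma late_hit_exits n m : (n <= m)%N -> late_hit I m B `&` exits J n (~` I) = set0.
Proof.
move=> nm; rewrite -subset0 => s [[k mk [kI _]] [j jn [_ [nI _]]]].
by apply: nI; apply: kI; exact: leq_ltn_trans (leq_trans jn nm) mk.
Qed.

(** As [J] is inside [I], a first exit from [J] that lands outside [I] is the first exit from [I]:
    the two exit times agree, hence so do the exit points. *)
Lemma late_hit0_exits n : late_hit I 0 B `&` exits J n (~` I) `<=` exits J n B.
Proof.
move=> s [[k _ [kI sB]] [j jn [jJ [nI nJ]]]]; exists j => //; split => //.
split => //; have [jk|kj|-> //] := ltngtP j k; first by case: nI; exact: kI.
by have := BI sB; case; exact/JI/jJ.
Qed.

Lemma exits_late_hit0 n s : I (s 0%N) -> exits J n B s -> late_hit I 0 B s.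
Proof.
move=> I0 [[|k] kn [kJ [sB _]]]; first by have := BI sB.
by exists k.+1 => //; split => // i /kJ; exact: JI.
Qed.

End domain.
End trajectories.

(** * The strong Markov property *)

Section history_theory.
Context {R : realType} {S : pmetricType R} {d : measure_display}
  {Omega : measurableType d}.
Variable X : nat -> Omega -> S.
Hypothesis mX : forall j, measurable_fun setT (X j : Omega -> Borel S).

Lemma history_preimage n j (B : set (Borel S)) :
  (j <= n)%N -> measurable B -> history X n (X j @^-1` B).
Proof.
move=> jn mB; apply: sub_sigma_algebra; exists j => //=.
by exists B => //; rewrite setTI.
Qed.

Lemma history_le m n : (m <= n)%N -> history X m `<=` history X n.
Proof.
move=> mn; apply: smallest_sub; first exact: smallest_sigma_algebra.
move=> H [j /= jm [B mB <-]]; rewrite setTI.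
exact: history_preimage (leq_trans jm mn) mB.
Qed.

Lemma history_measurable n : history X n `<=` measurable.
Proof.
apply: smallest_sub; first exact: sigma_algebra_measurable.
by move=> H [j /= jm [B mB <-]]; exact: mX.
Qed.

Lemma historyI n H1 H2 :
  history X n H1 -> history X n H2 -> history X n (H1 `&` H2).
Proof. exact: (@measurableI _ (g_sigma_algebraType _)). Qed.

Lemma history_cond n (P : Prop) H : history X n H ->
  history X n [set w | P -> H w].
Proof.
move=> hH; have [p|np] := pselect P.
  by rewrite (_ : [set w | _] = H)//; apply/seteqP; split => w //=; exact.
rewrite (_ : [set w | _] = setT); last by apply/seteqP; split => // w _ /np.
exact: (@measurableT _ (g_sigma_algebraType _)).
Qed.

Lemma history_bigcap n (H : nat -> set Omega) :
  (forall j, history X n (H j)) -> history X n [set w | forall j, H j w].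
Proof.
move=> hH; rewrite (_ : [set w | _] = \bigcap_j H j).
  exact: (@bigcapT_measurable _ (g_sigma_algebraType _)).
by apply/seteqP; split => w // + j; exact.
Qed.

End history_theory.

(** * The Markov property for events on trajectories *)

Section markov_property.
Context {R : realType} {S : pmetricType R} {d : measure_display}
  {Omega : measurableType d}.
Variables (P : probability Omega R) (K : R.-pker (Borel S) ~> (Borel S))
  (X : S -> nat -> Omega -> S).
Hypothesis hX : forall x, markov_chain P K x (X x).
Implicit Types (x y : S) (j k m n : nat) (Phi : set (nat -> S)).

Lemma measurable_chain x j : measurable_fun setT (X x j : Omega -> Borel S).
Proof. by have [] := hX x. Qed.
#[local] Hint Resolve measurable_chain : core.

Lemma chain0 x w : X x 0 w = x.
Proof. by have [_ ->] := hX x. Qed.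

Definition pathwise Phi y : set Omega := [set w | Phi (X y ^~ w)].

Definition future j Phi y : set Omega := pathwise (shifted j Phi) y.

(** The trajectory space carries no sigma-algebra here, so the measurability of the events and the
    measurable dependence on the starting point are made part of the property. *)
Definition has_markov_property Phi :=
  [/\ forall y j, measurable (future j Phi y),
      measurable_fun setT (fun y : Borel S => P (pathwise Phi y))
    & forall y j H, history (X y) j H ->
        P (H `&` future j Phi y) = \int[P]_(w in H) P (pathwise Phi (X y j w))].

Lemma integral_next x n H (f : Borel S -> \bar R) : history (X x) n H ->
  measurable_fun setT f -> (forall z, 0 <= f z) ->
  \int[P]_(w in H) f (X x n.+1 w) = \int[P]_(w in H) \int[K (X x n w)]_z f z.
Proof.
move=> hH mf f0; have mH := history_measurable (measurable_chain x) hH.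
have [_ _ XK] := hX x.
(* The definition of the chain only covers indicators; both sides are integrals
   of [f] against kernels, a Dirac kernel on the left. *)
have fE w : f (X x n.+1 w) = \int[kdirac (measurable_chain x n.+1) w]_z f z.
  by rewrite /kdirac integral_dirac// diracT mul1e.
under eq_integral do rewrite fE.
apply: eq_ge0_integral_kernel => // [E mE|E mE|E mE].
- exact: measurable_kernel (kdirac (measurable_chain x n.+1)) _ mE.
- exact: measurableT_comp (measurable_kernel K _ mE) _.
rewrite -XK// setIC -integral_indic//.
by rewrite -[X in measurable X]setTI; exact: measurable_chain.
Qed.

Lemma future_stay_then0 j D B y :
  future j (stay_then D 0 B) y = X y j @^-1` B.
Proof.
by apply/seteqP; split => w /=;
  rewrite /future /pathwise /shifted /stay_then /= addn0 //; case.
Qed.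

Lemma future_stay_thenS j D k B y :
  future j (stay_then D k.+1 B) y =
  X y j @^-1` D `&` future j.+1 (stay_then D k B) y.
Proof.
apply/seteqP; split => w /=; rewrite /future /pathwise /shifted /stay_then /=.
  move=> [Dw Bw]; rewrite addSnnS; split; first by by have := Dw 0%N; rewrite addn0; exact.
  by split => // i ik; rewrite addSnnS; exact: Dw.
rewrite addSnnS => -[D0 [Dw Bw]]; split => // -[|i]; rewrite ?addn0// ltnS => ik.
by have := Dw _ ik; rewrite addSnnS.
Qed.

Lemma measurable_future_stay_then D k B y j : measurable (D : set (Borel S)) ->
  measurable (B : set (Borel S)) -> measurable (future j (stay_then D k B) y).
Proof.
move=> mD mB; elim: k j => [|k IH] j.
  by rewrite future_stay_then0 -[X in measurable X]setTI; exact: measurable_chain.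
rewrite future_stay_thenS; apply: measurableI => //.
by rewrite -[X in measurable X]setTI; exact: measurable_chain.
Qed.

(** Induction on [k]: the current position is absorbed into the history event, the case [k] is
    applied at time [j.+1], and [integral_next] brings the integral back to time [j]. The new
    density is the kernel integral of the old one, cut off outside [D]. *)
Lemma stay_then_density D k B : measurable (D : set (Borel S)) ->
  measurable (B : set (Borel S)) ->
  exists r : Borel S -> \bar R, [/\ measurable_fun setT r, forall z, 0 <= r z &
    forall y j H, history (X y) j H ->
      P (H `&` future j (stay_then D k B) y) = \int[P]_(w in H) r (X y j w)].
Proof.
move=> mD mB; elim: k => [|k [r [mr r0 IH]]].
  exists (fun z => (\1_B z)%:E); split => [|z|y j H hH].
  - exact/measurable_EFinP/measurable_indic.
  - by rewrite lee_fin.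
  have mH := history_measurable (measurable_chain y) hH.
  rewrite future_stay_then0 setIC -integral_indic//.
  by rewrite -[X in measurable X]setTI; exact: measurable_chain.
pose r' (z : Borel S) := \int[K z]_u r u.
have mr' : measurable_fun setT r'.
  exact: (measurable_fun_integral_kernel (@measurable_kernel _ _ _ _ _ K) r0 mr).
exists (r' \_ D); split => [|z|y j H hH].
- by apply/(measurable_restrictT _ mD); exact: (measurable_funS measurableT).
- by apply: erestrict_ge0 => u _; exact: integral_ge0.
have mH := history_measurable (measurable_chain y) hH.
rewrite future_stay_thenS setIA.
have hHD : history (X y) j (H `&` X y j @^-1` D).
  by apply: historyI => //; exact: history_preimage.
rewrite IH; last exact: history_le hHD.
by rewrite integral_next// integral_mkcondr.
Qed.

Lemma has_markov_property_stay_then D k B : measurable (D : set (Borel S)) ->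
  measurable (B : set (Borel S)) -> has_markov_property (stay_then D k B).
Proof.
move=> mD mB; have [r [mr r0 rE]] := stay_then_density k mD mB.
(* At time 0 the state is the fixed [y], so [H = setT] identifies the density with the
   probability. *)
have PE y : P (pathwise (stay_then D k B) y) = r y.
  have := rE y 0%N setT (@measurableT _ (g_sigma_algebraType _)).
  rewrite setTI => ->; under eq_integral do rewrite chain0.
  by rewrite integral_cst// [X in _ * X]probability_setT mule1.
split=> [y j||y j H hH].
- exact: measurable_future_stay_then.
- by under eq_fun do rewrite PE.
- by rewrite rE//; apply: eq_integral => w _; rewrite PE.
Qed.

(** Both sides of the Markov identity are countably additive in the event. This carries it from a
    fixed exit time to [late_hit], where the exit time is unbounded. *)
Lemma has_markov_property_bigcup (Phi : nat -> set (nat -> S)) :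
  trivIset setT Phi -> (forall k, has_markov_property (Phi k)) ->
  has_markov_property (\bigcup_k Phi k).
Proof.
move=> tPhi mPhi.
have fE j y : future j (\bigcup_k Phi k) y = \bigcup_k future j (Phi k) y by [].
have mf k y j : measurable (future j (Phi k) y) by have [] := mPhi k.
have tf j y : trivIset setT (fun k => future j (Phi k) y).
  apply/trivIsetP => k l _ _ kl; move/trivIsetP : tPhi => /(_ k l I I kl) kl0.
  rewrite -subset0 => w [wk wl].
  have : (Phi k `&` Phi l) (fun i => X y (j + i)%N w) by split.
  by rewrite kl0.
have PE y : P (pathwise (\bigcup_k Phi k) y) = \sum_(k <oo) P (pathwise (Phi k) y).
  rewrite [pathwise _ _](fE 0%N y) measure_semi_bigcup//.
  exact: bigcupT_measurable.
split=> [y j||y j H hH].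
- by rewrite fE; exact: bigcupT_measurable.
- under eq_fun do rewrite PE.
  by apply: ge0_emeasurable_sum => // k; have [] := mPhi k.
have mH := history_measurable (measurable_chain y) hH.
rewrite fE setI_bigcupr measure_semi_bigcup.
- under [RHS]eq_integral do rewrite PE.
  rewrite integral_nneseries//.
    by apply: eq_eseriesr => k _; have [_ _ mp] := mPhi k; exact: mp.
  move=> k; apply: measurable_funS (measurableT) _ _ => //.
  by have [_ mk _] := mPhi k; exact: measurableT_comp mk (measurable_chain y j).
- by move=> k; exact: measurableI.
- exact: trivIset_setIl.
- by apply: bigcupT_measurable => k; exact: measurableI.
Qed.

End markov_property.

(** * Probabilities as real numbers *)

Section real_probability.
Context {R : realType} {d : measure_display} {Omega : measurableType d}.
Variable P : probability Omega R.
Implicit Types E F : set Omega.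

Lemma fine_probabilityK E : measurable E -> (fine (P E))%:E = P E.
Proof. by move=> mE; rewrite fineK// fin_num_measure. Qed.

Lemma fine_probability_ge0 E : (0 <= fine (P E))%R.
Proof. exact/fine_ge0/measure_ge0. Qed.

Lemma fine_probability_le1 E : measurable E -> (fine (P E) <= 1)%R.
Proof. by move=> mE; rewrite -lee_fin fine_probabilityK// probability_le1. Qed.

Lemma le_fine_probability E F : measurable E -> measurable F -> E `<=` F ->
  (fine (P E) <= fine (P F))%R.
Proof.
by move=> mE mF EF; rewrite -lee_fin !fine_probabilityK// le_measure// inE.
Qed.

Lemma fine_probabilityU E F : measurable E -> measurable F ->
  (fine (P (E `|` F)) <= fine (P E) + fine (P F))%R.
Proof.
move=> mE mF; rewrite -lee_fin EFinD !fine_probabilityK//; last exact: measurableU.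
exact: measureU2.
Qed.

Lemma fine_probabilityU_disjoint E F : measurable E -> measurable F ->
  E `&` F = set0 -> (fine (P (E `|` F)) = fine (P E) + fine (P F))%R.
Proof.
move=> mE mF EF; apply: EFin_inj; rewrite EFinD !fine_probabilityK//.
  exact: measureU.
exact: measurableU.
Qed.

Lemma fine_probabilityD E F : measurable E -> measurable F -> F `<=` E ->
  (fine (P (E `\` F)) = fine (P E) - fine (P F))%R.
Proof.
move=> mE mF FE; rewrite -{2}(setDUK FE) fine_probabilityU_disjoint//.
- by rewrite addrAC subrr add0r.
- exact: measurableD.
- by rewrite setDE setICA setICr setI0.
Qed.

Lemma fine_probabilityT : fine (P setT) = 1%R.
Proof. by rewrite probability_setT. Qed.

End real_probability.

(** * Markov inequalities at a stopping time *)

Section stopping.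
Context {R : realType} {S : pmetricType R} {d : measure_display}
  {Omega : measurableType d}.
Variables (P : probability Omega R) (K : R.-pker (Borel S) ~> (Borel S))
  (X : S -> nat -> Omega -> S).
Hypothesis hX : forall x, markov_chain P K x (X x).
Implicit Types (x y : S) (j k l m n : nat) (Phi : set (nat -> S)).
Implicit Types (I J A B D : set (Borel S)) (E : set Omega) (c : R).

Let mX x j : measurable_fun setT (X x j : Omega -> Borel S).
Proof. exact: measurable_chain hX x j. Qed.

Lemma measurable_pathwise Phi y : has_markov_property P X Phi ->
  measurable (pathwise X Phi y).
Proof. by case=> /(_ y 0%N). Qed.

Lemma measurable_exits J n B y : measurable J -> measurable B ->
  measurable (pathwise X (exits J n B) y).
Proof.
move=> mJ mB; rewrite (_ : pathwise _ _ _ =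
    \bigcup_(k in [set k | (k <= n)%N]) pathwise X (stay_then J k (B `\` J)) y).
  apply: bigcup_measurable => k _; apply: measurable_pathwise.
  by apply: (has_markov_property_stay_then hX) => //; exact: measurableD.
by apply/seteqP; split => w [k kn sw]; exists k.
Qed.

(** Disjoint union over the exit time: [B] lies outside [I], so being in [B] at one time excludes
    staying in [I] up to a later exit. *)
Lemma has_markov_property_late_hit I m B : measurable I -> measurable B ->
  B `<=` ~` I -> has_markov_property P X (late_hit I m B).
Proof.
move=> mI mB BI; rewrite (_ : late_hit _ _ _ =
    \bigcup_n stay_then I (m.+1 + n)%N B); last first.
  apply/seteqP; split => s; last by case=> n _ sn; exists (m.+1 + n)%N => //; rewrite ltnS leq_addr.
  by case=> k mk sk; exists (k - m.+1)%N => //; rewrite subnKC.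
apply: (has_markov_property_bigcup hX) => [|n]; last exact: (has_markov_property_stay_then hX).
apply/trivIsetP => i j _ _; wlog ij : i j / (i < j)%N => [H|_].
  by rewrite neq_ltn => /orP[|] ij; [|rewrite setIC]; apply: H => //; rewrite neq_ltn ij.
rewrite -subset0 => s [[_ /BI sB] [sI _]]; apply: sB; apply: sI.
by rewrite ltn_add2l.
Qed.

(** The end of a cycle is a stopping time: whether it equals [j] is decided by the states up to time
    [j]. *)
Lemma history_regen J A l n j y : measurable J -> measurable A ->
  history (X y) j (pathwise X (regen J A l n j) y).
Proof.
move=> mJ mA.
have hT : history (X y) j setT by exact: (@measurableT _ (g_sigma_algebraType _)).
have h0 : history (X y) j set0 by exact: (@measurable0 _ (g_sigma_algebraType _)).
have [ljn|ljn] := boolP (l <= j <= l + n)%N; last first.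
  by rewrite (_ : pathwise _ _ _ = set0)// -subset0 => w [ljn' _ _ _]; rewrite ljn' in ljn.
rewrite (_ : pathwise _ _ _ = [set w | forall i, (i <= j)%N -> (X y i @^-1` J) w] `&`
  [set w | forall i, (l <= i < j)%N -> (X y i @^-1` ~` A) w] `&` X y j @^-1` A).
  apply: historyI; first apply: historyI.
  - apply: history_bigcap => i; have [ij|ij] := boolP (i <= j)%N.
      by apply: history_cond; exact: history_preimage.
    rewrite [X in history _ _ X](_ : _ = setT)//.
    by apply/seteqP; split => // w _ /= ij'; rewrite ij' in ij.
  - apply: history_bigcap => i; have [ij|ij] := boolP (l <= i < j)%N.
      apply: history_cond; apply: history_preimage; last exact: measurableC.
      by case/andP: ij => _ /ltnW.
    rewrite [X in history _ _ X](_ : _ = setT)//.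
    by apply/seteqP; split => // w _ /= ij'; rewrite ij' in ij.
  - exact: history_preimage.
by apply/seteqP; split => w [] => [|[]] *; split.
Qed.

Lemma measurable_regen J A l n j y : measurable J -> measurable A ->
  measurable (pathwise X (regen J A l n j) y).
Proof.
move=> mJ mA; have hR := @history_regen _ _ l n j y mJ mA.
exact (history_measurable (mX y) hR).
Qed.

Let measurable_prob_after Phi y j H : has_markov_property P X Phi ->
  measurable_fun H (fun w => P (pathwise X Phi (X y j w))).
Proof.
move=> [_ mPhi _]; apply: (measurable_funS measurableT) => //.
exact: measurableT_comp mPhi (mX y j).
Qed.

Lemma markov_le Phi A c y j H : has_markov_property P X Phi ->
  history (X y) j H -> (forall w, H w -> A (X y j w)) ->
  (forall z, A z -> P (pathwise X Phi z) <= c%:E) ->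
  P (H `&` future X j Phi y) <= c%:E * P H.
Proof.
move=> mPhi hH HA Ac; have mH := history_measurable (mX y) hH.
have [_ _ ->//] := mPhi; rewrite -integral_cst//.
have [->|/set0P[w Hw]] := eqVneq H set0; first by rewrite !integral_set0.
(* The sign of [c] comes from a point of [H], where [c] bounds a probability. *)
have c0 : (0 <= c)%R by rewrite -lee_fin (le_trans _ (Ac _ (HA _ Hw))).
apply: ge0_le_integral => //; first exact: measurable_prob_after.
by move=> v Hv; exact/Ac/HA.
Qed.

Lemma markov_ge Phi A c y j H : (0 <= c)%R -> has_markov_property P X Phi ->
  history (X y) j H -> (forall w, H w -> A (X y j w)) ->
  (forall z, A z -> c%:E <= P (pathwise X Phi z)) ->
  c%:E * P H <= P (H `&` future X j Phi y).
Proof.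
move=> c0 mPhi hH HA Ac; have mH := history_measurable (mX y) hH.
have [_ _ ->//] := mPhi; rewrite -integral_cst//.
apply: ge0_le_integral => //; first exact: measurable_prob_after.
by move=> v Hv; exact/Ac/HA.
Qed.

Section stopping_time.
Variables (A : set (Borel S)) (x : S) (H : nat -> set Omega).
Hypotheses (tH : trivIset setT H) (hH : forall j, history (X x) j (H j))
  (HA : forall j w, H j w -> A (X x j w)).

Let mH j : measurable (H j).
Proof. exact (history_measurable (mX x) (@hH j)). Qed.

Let mbigH : measurable (\bigcup_j H j).
Proof. exact: bigcupT_measurable. Qed.

(** [H j] plays the event that a stopping time equals [j], with the state then in [A]. The Markov
    inequality is summed over [j]; the inclusion hypothesis trades [E] for an event on the future
    after [j]. *)
Lemma strong_markov_le Phi c E : has_markov_property P X Phi -> (0 <= c)%R ->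
  measurable E -> (forall j, H j `&` E `<=` future X j Phi x) ->
  (forall z, A z -> (fine (P (pathwise X Phi z)) <= c)%R) ->
  (fine (P ((\bigcup_j H j) `&` E)) <= c * fine (P (\bigcup_j H j)))%R.
Proof.
move=> mPhi c0 mE EPhi Ac; rewrite -lee_fin EFinM !fine_probabilityK//; last exact: measurableI.
rewrite setI_bigcupl !measure_semi_bigcup//; last 3 first.
- by move=> j; exact: measurableI.
- rewrite (_ : (fun j => _) = (fun j => E `&` H j)); first exact: trivIset_setIl.
  by apply/funext => j; rewrite setIC.
- by rewrite -setI_bigcupl; exact: measurableI.
rewrite -nneseriesZl//; apply: lee_nneseries => // j _.
apply: le_trans (markov_le mPhi (@hH j) (@HA j) _).
  apply: le_measure; rewrite ?inE; [exact: measurableI| |].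
    by apply: measurableI => //; have [] := mPhi.
  by move=> w [Hw Ew]; split => //; apply: EPhi.
by move=> z /Ac; rewrite -lee_fin fine_probabilityK//; exact: measurable_pathwise.
Qed.

Lemma strong_markov_ge Phi c E : has_markov_property P X Phi -> (0 <= c)%R ->
  measurable E -> (forall j, H j `&` future X j Phi x `<=` E) ->
  (forall z, A z -> (c <= fine (P (pathwise X Phi z)))%R) ->
  (c * fine (P (\bigcup_j H j)) <= fine (P ((\bigcup_j H j) `&` E)))%R.
Proof.
move=> mPhi c0 mE EPhi Ac; rewrite -lee_fin EFinM !fine_probabilityK//; last exact: measurableI.
rewrite setI_bigcupl !measure_semi_bigcup//; last 3 first.
- by move=> j; exact: measurableI.
- rewrite (_ : (fun j => _) = (fun j => E `&` H j)); first exact: trivIset_setIl.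
  by apply/funext => j; rewrite setIC.
- by rewrite -setI_bigcupl; exact: measurableI.
rewrite -nneseriesZl//; apply: lee_nneseries => [j _ _|j _]; first by rewrite mule_ge0.
apply: le_trans (markov_ge c0 mPhi (@hH j) (@HA j) _) _.
  by move=> z /Ac; rewrite -lee_fin fine_probabilityK//; exact: measurable_pathwise.
apply: le_measure; rewrite ?inE; [|exact: measurableI|].
  by apply: measurableI => //; have [] := mPhi.
by move=> w [Hw Fw]; split => //; apply: (EPhi j).
Qed.

End stopping_time.
End stopping.

(** * One cycle, and its iteration *)

Section cycle.
Context {R : realType} {S : pmetricType R} {d : measure_display}
  {Omega : measurableType d}.
Variables (P : probability Omega R) (K : R.-pker (Borel S) ~> (Borel S))
  (X : S -> nat -> Omega -> S).
Hypothesis hX : forall x, markov_chain P K x (X x).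
Variables (I J A B : set (Borel S)) (l n : nat).
Hypotheses (mI : measurable I) (mJ : measurable J) (mA : measurable A)
  (mB : measurable B) (JI : J `<=` I) (BI : B `<=` ~` I).
Implicit Types (y z : S) (c s : R).

Local Notation pr Phi y := (fine (P (pathwise X Phi y))).
Local Notation returns y := (\bigcup_j pathwise X (regen J A l n j) y).
Local Notation avoid := (stay_then (J `\` A) n (J `\` A)).

Let mR y : measurable (returns y).
Proof. by apply: bigcupT_measurable => j; exact: (measurable_regen hX). Qed.

Let mE m D y : measurable D -> measurable (pathwise X (exits J m D) y).
Proof. exact: (measurable_exits hX). Qed.

Let mJA : measurable (J `\` A). Proof. exact: measurableD. Qed.

Let markov_avoid : has_markov_property P X avoid.
Proof. exact: (has_markov_property_stay_then hX). Qed.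

Let markov_late m : has_markov_property P X (late_hit I m B).
Proof. exact: (has_markov_property_late_hit hX). Qed.

Let mL m y : measurable (pathwise X (late_hit I m B) y).
Proof. exact: measurable_pathwise. Qed.

Local Notation late_avoid y := ((X y l @^-1` J) `&` future X l avoid y).

Let m_late_avoid y : measurable (late_avoid y).
Proof.
apply: measurableI; last by have [] := markov_avoid.
by rewrite -[X in measurable X]setTI; exact: (measurable_chain hX).
Qed.

Let late_avoid_le s y : (forall z, J z -> (pr avoid z <= s)%R) -> (0 <= s)%R ->
  (fine (P (late_avoid y)) <= s)%R.
Proof.
move=> Js s0; rewrite -lee_fin fine_probabilityK//.
apply: le_trans (markov_le hX (A := J) (c := s) markov_avoid _ _ _) _.
- by apply: history_preimage.
- by [].
- move=> z /Js; rewrite -lee_fin fine_probabilityK//. exact: (measurable_pathwise z markov_avoid).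
rewrite -[leRHS]mule1 lee_wpmul2l ?lee_fin// probability_le1//.
by rewrite -[X in measurable X]setTI; exact: (measurable_chain hX).
Qed.

Let returns_cover y : setT `<=`
  (returns y `|` pathwise X (exits J (l + n) setT) y) `|` late_avoid y.
Proof.
by move=> w _; have [|?|?] := regen_cover J A l n (X y ^~ w); [left; left|left; right|right].
Qed.

(** Union bound over the three fates of a cycle. *)
Let returns_ge_late y : (1 - pr (exits J (l + n) setT) y - fine (P (late_avoid y)) <=
  fine (P (returns y)))%R.
Proof.
rewrite lerBlDr lerBlDr -(fine_probabilityT P).
have mEy : measurable (pathwise X (exits J (l + n) setT) y) by exact: mE.
have mU := measurableU _ _ (mR y) mEy.
have mUU := measurableU _ _ mU (m_late_avoid y).
apply: le_trans (le_fine_probability P measurableT mUU (@returns_cover y)) _.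
apply: le_trans (fine_probabilityU P mU (m_late_avoid y)) _.
by rewrite [leRHS]addrAC lerD2r; exact: fine_probabilityU.
Qed.

Lemma returns_ge s y : (forall z, J z -> (pr avoid z <= s)%R) -> (0 <= s)%R ->
  (1 - pr (exits J (l + n) setT) y - s <= fine (P (returns y)))%R.
Proof.
move=> Js s0; apply: le_trans (returns_ge_late y).
by rewrite lerD2l lerN2; exact: late_avoid_le.
Qed.

(** Meant for the initial phase, with [J := I]: avoidance enters only at the starting point [y],
    because the estimates available there are uniform over a member of the covering and not over
    [I]. *)
Lemma returns_ge0 y : l = 0%N ->
  (1 - pr (exits J n setT) y - pr avoid y <= fine (P (returns y)))%R.
Proof.
move=> l0; have := returns_ge_late y; rewrite {1}l0 add0n; apply: le_trans.
rewrite lerD2l lerN2; apply: le_fine_probability => //.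
  exact: (measurable_pathwise y markov_avoid).
by rewrite l0 => w [].
Qed.

Let returns_exits y D : returns y `&` pathwise X (exits J l D) y = set0.
Proof. by rewrite -subset0 => w [[j _ /regen_not_exits]]; apply. Qed.

Lemma returns_le y : (fine (P (returns y)) <= 1 - pr (exits J l setT) y)%R.
Proof.
have mEl : measurable (pathwise X (exits J l setT) y) by exact: mE.
rewrite lerBrDr -fine_probabilityU_disjoint//.
by apply: fine_probability_le1; exact: measurableU.
Qed.

Let returns_late_hit_le m c y : (0 <= c)%R ->
  (forall z, A z -> (pr (late_hit I (m - (l + n)) B) z <= c)%R) ->
  (fine (P (returns y `&` pathwise X (late_hit I m B) y)) <= c * fine (P (returns y)))%R.
Proof.
move=> c0 Ac; apply: (strong_markov_le hX (A := A)) Ac => //.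
- apply/trivIsetP => i j _ _ ij; rewrite -subset0 => w [wi wj].
  have /trivIsetP /(_ i j Logic.I Logic.I ij) := @regen_disjoint _ J A l n.
  by move=> ij0; have : set0 (X y ^~ w) by rewrite -ij0.
- by move=> j; exact (@history_regen _ _ _ _ X J A l n j y mJ mA).
- by move=> j w [].
- by move=> j w [/= wj wl]; exact: late_hit_regen wj wl.
Qed.

(** Every path without a return is charged in full. This is too coarse for a cycle that is iterated,
    but it suits the initial phase, which occurs once. *)
Lemma late_hit_le_returns m c y : (0 <= c)%R ->
  (forall z, A z -> (pr (late_hit I (m - (l + n)) B) z <= c)%R) ->
  (pr (late_hit I m B) y <= c + (1 - fine (P (returns y))))%R.
Proof.
move=> c0 Ac.
have cR : (c * fine (P (returns y)) <= c)%R.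
  by rewrite ler_piMr// fine_probability_le1.
have -> : (1 - fine (P (returns y)) = fine (P (~` returns y)))%R.
  by rewrite -setTD fine_probabilityD// fine_probabilityT.
have mC : measurable (~` returns y) by exact: measurableC.
have mRL : measurable (returns y `&` pathwise X (late_hit I m B) y) by exact: measurableI.
apply: (@le_trans _ _ (fine (P ((returns y `&` pathwise X (late_hit I m B) y) `|` ~` returns y)))).
  apply: le_fine_probability => //; first exact: measurableU.
  by move=> w wL; have [wR|wR] := pselect (returns y w); [left|right].
apply: le_trans (fine_probabilityU P _ _) _ => //; rewrite lerD2r.
exact: le_trans (returns_late_hit_le _ c0 Ac) cR.
Qed.

(** A return restarts the chain in [A]. Otherwise the chain leaves [J] by time [l], outside [I] or
    into [I], or it leaves [J] between [l] and [l + n], or it waits too long; all but the first of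
    these are the small terms. The exit outside [I] is kept joint with the late hit: it is null for
    [l <= m] and an exit into [B] for [m = 0]. *)
Lemma late_hit_le_cycle s m c y : (0 <= c)%R ->
  (forall z, J z -> (pr avoid z <= s)%R) -> (0 <= s)%R ->
  (forall z, A z -> (pr (late_hit I (m - (l + n)) B) z <= c)%R) ->
  (pr (late_hit I m B) y <= c * fine (P (returns y)) +
    fine (P (pathwise X (late_hit I m B) y `&` pathwise X (exits J l (~` I)) y)) +
    (pr (exits J l I) y + (pr (exits J (l + n) setT) y - pr (exits J l setT) y) + s))%R.
Proof.
move=> c0 Js s0 Ac.
have mIC : measurable (~` I) by exact: measurableC.
have mT : measurable (setT : set (Borel S)) by exact: measurableT.
rewrite -fine_probabilityD//; [|exact: mE|exact: mE|]; last first.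
  by move=> w; apply: exits_le; rewrite leq_addr.
have mD : measurable (pathwise X (exits J (l + n) setT) y `\` pathwise X (exits J l setT) y).
  by apply: measurableD; exact: mE.
have mLR : measurable (returns y `&` pathwise X (late_hit I m B) y) by exact: measurableI.
have mLE : measurable (pathwise X (late_hit I m B) y `&` pathwise X (exits J l (~` I)) y).
  by apply: measurableI => //; exact: mE.
have mEI := @mE l I y mI.
apply: (@le_trans _ _ (fine (P (
    ((returns y `&` pathwise X (late_hit I m B) y) `|`
     (pathwise X (late_hit I m B) y `&` pathwise X (exits J l (~` I)) y)) `|`
    ((pathwise X (exits J l I) y `|`
      (pathwise X (exits J (l + n) setT) y `\` pathwise X (exits J l setT) y)) `|`
     late_avoid y))))).
  apply: le_fine_probability => //.
    by repeat apply: measurableU => //.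
  move=> w wL; have [[wR|wE]|wA] := @returns_cover y w Logic.I.
  - by left; left.
  - have [wEl|wEl] := pselect (pathwise X (exits J l setT) y w).
      by have [] := @exits_split _ J l I _ wEl; [right; left; left|left; right].
    by right; left; right.
  - by right; right.
have mU1 := measurableU _ _ mLR mLE.
have mU2 := measurableU _ _ mEI mD.
have mU3 := measurableU _ _ mU2 (m_late_avoid y).
apply: le_trans (fine_probabilityU P mU1 mU3) _.
apply: lerD; first apply: le_trans (fine_probabilityU P mLR mLE) _.
  by rewrite lerD2r; exact: returns_late_hit_le.
apply: le_trans (fine_probabilityU P mU2 (m_late_avoid y)) _.
by apply: lerD; [exact: fine_probabilityU|exact: late_avoid_le].
Qed.

Lemma late_hit_exits_pr0 m y : (l <= m)%N ->
  fine (P (pathwise X (late_hit I m B) y `&` pathwise X (exits J l (~` I)) y)) = 0%R.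
Proof.
move=> lm; rewrite (_ : _ `&` _ = set0) ?measure0//.
rewrite -subset0 => w [wL wE].
have : (late_hit I m B `&` exits J l (~` I)) (X y ^~ w) by split.
by rewrite late_hit_exits.
Qed.

Lemma late_hit0_exits_pr y :
  (fine (P (pathwise X (late_hit I 0 B) y `&` pathwise X (exits J l (~` I)) y)) <=
   pr (exits J l B) y)%R.
Proof.
have mEC : measurable (pathwise X (exits J l (~` I)) y).
  by apply: mE; exact: measurableC.
apply: le_fine_probability; [exact: measurableI|exact: mE|].
by move=> w [wL wE]; exact: (late_hit0_exits JI BI).
Qed.

Lemma returns_ge_cycle Phi E c y : has_markov_property P X Phi -> (0 <= c)%R ->
  measurable E ->
  (forall j, pathwise X (regen J A l n j) y `&` future X j Phi y `<=` E) ->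
  (forall z, A z -> (c <= pr Phi z)%R) ->
  (c * fine (P (returns y)) <= fine (P (returns y `&` E)))%R.
Proof.
move=> mPhi c0 mEv EPhi Ac; apply: (strong_markov_ge hX (A := A)) Ac => //.
- apply/trivIsetP => i j _ _ ij; rewrite -subset0 => w [wi wj].
  have /trivIsetP /(_ i j Logic.I Logic.I ij) := @regen_disjoint _ J A l n.
  by move=> ij0; have : set0 (X y ^~ w) by rewrite -ij0.
- by move=> j; exact (@history_regen _ _ _ _ X J A l n j y mJ mA).
- by move=> j w [].
Qed.

Lemma late_hit_ge_returns m c y : (0 <= c)%R ->
  (forall z, A z -> (c <= pr (late_hit I (m - l) B) z)%R) ->
  (c * fine (P (returns y)) <= pr (late_hit I m B) y)%R.
Proof.
move=> c0 Ac; apply: le_trans (returns_ge_cycle _ c0 (mL m y) _ Ac) _ => //.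
  by move=> j w [wR wL]; exact: regen_late_hit wR wL.
by apply: le_fine_probability => //; exact: measurableI.
Qed.

(** Exits into [B] by time [l] and exits after a return are disjoint, so their probabilities add;
    the first is the source term of the fixpoint inequality. *)
Lemma late_hit0_ge_returns c y : I y -> (0 <= c)%R ->
  (forall z, A z -> (c <= pr (late_hit I 0 B) z)%R) ->
  (pr (exits J l B) y + c * fine (P (returns y)) <= pr (late_hit I 0 B) y)%R.
Proof.
move=> Iy c0 Ac; have mRL := measurableI _ _ (mR y) (mL 0 y).
have mEB := @mE l B y mB.
apply: (@le_trans _ _ (pr (exits J l B) y +
    fine (P (returns y `&` pathwise X (late_hit I 0 B) y)))%R).
  rewrite lerD2l; apply: (returns_ge_cycle (markov_late 0) c0 (mL 0 y) _ Ac) => j w [wR wL].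
  by apply: (@regen_late_hit _ I J A B JI l n j 0%N _ wR); rewrite sub0n.
rewrite -fine_probabilityU_disjoint//; last first.
  by rewrite setIA [X in X `&` _]setIC returns_exits set0I.
apply: le_fine_probability => //; first exact: measurableU.
move=> w [|[]//]; apply: exits_late_hit0 => //=.
by rewrite (chain0 hX).
Qed.

Lemma stay_ge_returns m c y : (0 <= c)%R ->
  (forall z, A z -> (c <= pr (stay_then I (m - l) I) z)%R) ->
  (c * fine (P (returns y)) <= pr (stay_then I m I) y)%R.
Proof.
have mS k : has_markov_property P X (stay_then I k I).
  exact: (has_markov_property_stay_then hX).
have mSy := measurable_pathwise y (mS m).
move=> c0 Ac; apply: le_trans (returns_ge_cycle _ c0 mSy _ Ac) _ => //.
  by move=> j w [wR wL]; exact: regen_stay wR wL.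
by apply: le_fine_probability => //; exact: measurableI.
Qed.

End cycle.

(** * Fixpoint inequalities for suprema and infima *)

Section fixpoint_inequalities.
Context {R : realType} {T : Type}.
Variables (A : set T) (f : T -> R).
Hypothesis f01 : forall z, A z -> (0 <= f z <= 1)%R.

(** Apply the step with [c] the supremum of [f] over [A], finite because [f] is at most 1, and solve
    the resulting inequality for it. The dual lemma does the same with the infimum. *)
Lemma sup_fixpoint_le (a b : R) : (0 < a)%R ->
  (forall c, (0 <= c)%R -> (forall z, A z -> (f z <= c)%R) ->
    forall z, A z -> (f z <= b + c * (1 - a))%R) ->
  forall z, A z -> (f z <= b / a)%R.
Proof.
move=> a0 step z Az; have fA0 : [set f y | y in A] !=set0 by exists (f z), z.
have ub : ubound [set f y | y in A] 1%R by move=> _ [y Ay <-]; case/andP: (f01 Ay).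
have le_sup y : A y -> (f y <= sup [set f y | y in A])%R.
  by move=> Ay; apply: ub_le_sup; [exists 1%R|exists y].
have s0 : (0 <= sup [set f y | y in A])%R.
  by apply: le_trans (le_sup _ Az); case/andP: (f01 Az).
have : (sup [set f y | y in A] <= b + sup [set f y | y in A] * (1 - a))%R.
  by apply: ge_sup => // _ [y Ay <-]; exact: step.
move=> H; apply: (le_trans (le_sup _ Az)); rewrite ler_pdivlMr//.
by move: H; set s := sup _; lra.
Qed.

Lemma inf_fixpoint_ge (a b : R) : (0 < a)%R ->
  (forall c, (0 <= c)%R -> (forall z, A z -> (c <= f z)%R) ->
    forall z, A z -> (b + c * (1 - a) <= f z)%R) ->
  forall z, A z -> (b / a <= f z)%R.
Proof.
move=> a0 step z Az; have fA0 : [set f y | y in A] !=set0 by exists (f z), z.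
have lb : lbound [set f y | y in A] 0%R by move=> _ [y Ay <-]; case/andP: (f01 Ay).
have inf_le y : A y -> (inf [set f y | y in A] <= f y)%R.
  by move=> Ay; apply: ge_inf; [exists 0%R|exists y].
have i0 : (0 <= inf [set f y | y in A])%R by apply: lb_le_inf.
have : (b + inf [set f y | y in A] * (1 - a) <= inf [set f y | y in A])%R.
  by apply: lb_le_inf => // _ [y Ay <-]; exact: step.
move=> H; apply: (le_trans _ (inf_le _ Az)); rewrite ler_pdivrMr//.
by move: H; set s := inf _; lra.
Qed.

End fixpoint_inequalities.

(** * Renewal inequalities and their iteration *)

Section renewal.
Context {R : realType} {S : pmetricType R} {d : measure_display}
  {Omega : measurableType d}.
Variables (P : probability Omega R) (K : R.-pker (Borel S) ~> (Borel S))
  (X : S -> nat -> Omega -> S).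
Hypothesis hX : forall x, markov_chain P K x (X x).
Variables (I J A : set (Borel S)) (l n : nat).
Hypotheses (mI : measurable I) (mJ : measurable J) (mA : measurable A)
  (JI : J `<=` I) (AI : A `<=` I).
Variables (rho s u : R).
Local Notation pr Phi y := (fine (P (pathwise X Phi y))).
Hypotheses (rho0 : (0 < rho)%R) (s0 : (0 <= s)%R)
  (exitT_le : forall y, A y -> (pr (exits J (l + n) setT) y <= rho * u)%R)
  (avoid_le : forall y, J y ->
    (pr (stay_then (J `\` A) n (J `\` A)) y <= rho * s)%R).
Implicit Types (y z : S) (c : R).

Let rs0 : (0 <= rho * s)%R. Proof. by rewrite mulr_ge0// ltW. Qed.

Let returns_ge_u y : A y ->
  (1 - rho * (u + s) <= fine (P (\bigcup_j pathwise X (regen J A l n j) y)))%R.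
Proof.
move=> Ay; apply: le_trans (returns_ge hX l mJ mA y avoid_le rs0).
by have := exitT_le Ay; lra.
Qed.

(** Each return takes at least [l] steps, all spent in [I], and ends in [A]; hence [N] returns in a
    row cover [m <= N * l] steps. *)
Lemma stay_ge_pow N m y : (0 <= 1 - rho * (u + s))%R -> (m <= N * l)%N -> A y ->
  ((1 - rho * (u + s)) ^+ N <= pr (stay_then I m I) y)%R.
Proof.
move=> q0; elim: N m y => [|N IH] m y mN Ay.
  move: mN; rewrite leqn0 => /eqP ->; rewrite expr0 -(fine_probabilityT P).
  have mS0 := measurable_pathwise y (has_markov_property_stay_then hX 0 mI mI).
  apply: le_fine_probability => // w _; split => //=.
  by rewrite (chain0 hX); exact: AI.
apply: le_trans (stay_ge_returns hX n mI mJ mA JI (c := (1 - rho * (u + s)) ^+ N) y _ _).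
- by rewrite exprS mulrC; apply: ler_wpM2l; [exact: exprn_ge0|exact: returns_ge_u].
- exact: exprn_ge0.
- by move=> z Az; apply: IH => //; rewrite leq_subLR -mulSn.
Qed.

Variable B : set (Borel S).
Hypotheses (mB : measurable B) (BI : B `<=` ~` I).

Let mL m y : measurable (pathwise X (late_hit I m B) y).
Proof. by apply: (measurable_pathwise y); exact: (has_markov_property_late_hit hX). Qed.

Let late01 m y : (0 <= pr (late_hit I m B) y <= 1)%R.
Proof. by rewrite fine_probability_ge0 fine_probability_le1. Qed.

Section lower.
Variable bl : R.
Hypotheses (exitB_ge : forall y, A y -> (rho * bl <= pr (exits J l B) y)%R).

(** The infimum [h] over [A] satisfies [h >= rho * bl + h * (1 - rho * (u + s))], and [rho] cancels
    in the solution. *)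
Lemma late_hit0_ge y : (0 < u + s)%R -> A y ->
  (bl / (u + s) <= pr (late_hit I 0 B) y)%R.
Proof.
move=> us0 Ay; have -> : (bl / (u + s) = (rho * bl) / (rho * (u + s)))%R.
  by rewrite -mulf_div divff ?mul1r// gt_eqF.
apply: (@inf_fixpoint_ge _ _ A (fun y => pr (late_hit I 0 B) y)) => //.
  by rewrite mulr_gt0.
move=> c c0 Ac z Az.
apply: le_trans (late_hit0_ge_returns hX l n mI mJ mA mB JI BI (AI Az) c0 Ac).
by apply: lerD; [exact: exitB_ge|apply: ler_wpM2l => //; exact: returns_ge_u].
Qed.

Lemma late_hit_ge_pow N m y : (0 < u + s)%R -> (0 <= bl)%R ->
  (0 <= 1 - rho * (u + s))%R -> (m <= N * l)%N -> A y ->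
  ((1 - rho * (u + s)) ^+ N * (bl / (u + s)) <= pr (late_hit I m B) y)%R.
Proof.
move=> us0 bl0 q0; have v0 : (0 <= bl / (u + s))%R by rewrite divr_ge0// ltW.
elim: N m y => [|N IH] m y mN Ay.
  by move: mN; rewrite leqn0 => /eqP ->; rewrite expr0 mul1r late_hit0_ge.
apply: le_trans (late_hit_ge_returns hX n mI mJ mA mB JI BI
  (c := (1 - rho * (u + s)) ^+ N * (bl / (u + s))) y _ _).
- rewrite exprS -mulrA mulrC; apply: ler_wpM2l; last exact: returns_ge_u.
  by rewrite mulr_ge0// exprn_ge0.
- by rewrite mulr_ge0// exprn_ge0.
- by move=> z Az; apply: IH => //; rewrite leq_subLR -mulSn.
Qed.

End lower.

Section upper.
Variables (bu t a : R).
Hypotheses (a0 : (0 < a)%R)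
  (exitB_le : forall y, A y -> (pr (exits J l B) y <= rho * bu)%R)
  (exitT_ge : forall y, A y -> (rho * a <= pr (exits J l setT) y)%R)
  (exitI_le : forall y, A y -> (pr (exits J l I) y <= rho * t)%R).
(** What can go wrong in a cycle, in units of [rho]: [t] for exits landing in [I], [u - a] for exits
    during the waiting phase, obtained as a difference of two horizons, and [s] for waiting too
    long. *)
Local Notation w := (t + (u - a) + s)%R.

Let late_hit_step m c y : (0 <= c)%R ->
  (forall z, A z -> (pr (late_hit I (m - (l + n)) B) z <= c)%R) -> A y ->
  (pr (late_hit I m B) y <= rho * w + fine (P (pathwise X (late_hit I m B) y `&`
      pathwise X (exits J l (~` I)) y)) + c * (1 - rho * a))%R.
Proof.
move=> c0 Ac Ay.
have H := late_hit_le_cycle hX mI mJ mA mB JI BI y c0 avoid_le rs0 Ac.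
apply: le_trans H _.
have cR : (c * fine (P (\bigcup_j pathwise X (regen J A l n j) y)) <= c * (1 - rho * a))%R.
  apply: ler_wpM2l => //; apply: le_trans (returns_le hX l n mJ mA y) _.
  by rewrite lerD2l lerN2 exitT_ge.
have := exitI_le Ay; have := exitT_le Ay; have := exitT_ge Ay.
by move: cR; lra.
Qed.

Lemma late_hit0_le y : A y -> (pr (late_hit I 0 B) y <= (bu + w) / a)%R.
Proof.
move=> Ay; have -> : ((bu + w) / a = (rho * (bu + w)) / (rho * a))%R.
  by rewrite -mulf_div divff ?mul1r// gt_eqF.
apply: (@sup_fixpoint_le _ _ A (fun y => pr (late_hit I 0 B) y)) => //.
  by rewrite mulr_gt0.
move=> c c0 Ac z Az; apply: le_trans (late_hit_step c0 _ Az) _ => //.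
rewrite lerD2r [leRHS]mulrDr addrC lerD2r.
exact: le_trans (late_hit0_exits_pr hX l mI mJ mB JI BI z) (exitB_le Az).
Qed.

(** [w / a] is the fixed point of [x = rho * w + (1 - rho * a) * x], so the errors of any number of
    cycles stay below it while the value at threshold 0 decays. The bound on [m] keeps the threshold
    at least [l] before each cycle, so exits outside [I] by time [l] contribute nothing. *)
Lemma late_hit_le_pow N m y : (0 <= w)%R -> (N * (l + n) <= m)%N -> A y ->
  (pr (late_hit I m B) y <= w / a + (1 - rho * a) ^+ N * ((bu + w) / a))%R.
Proof.
move=> w0 + Ay0; have v0 : (0 <= (bu + w) / a)%R.
  by apply: le_trans (late_hit0_le Ay0); exact: fine_probability_ge0.
have wa0 : (0 <= w / a)%R by rewrite divr_ge0// ltW.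
have q0 : (0 <= 1 - rho * a)%R.
  rewrite subr_ge0; apply: le_trans (exitT_ge Ay0) _.
  by apply: fine_probability_le1; exact: (measurable_exits hX).
elim: N m y Ay0 => [|N IH] m y Ay mN.
  rewrite expr0 mul1r; apply: le_trans (le_trans _ (late_hit0_le Ay)) _; last first.
    by rewrite lerDr.
  apply: le_fine_probability => // v [k mk vk]; exists k => //.
  exact: leq_trans mk.
have c0 : (0 <= w / a + (1 - rho * a) ^+ N * ((bu + w) / a))%R.
  by rewrite addr_ge0// mulr_ge0// exprn_ge0.
apply: le_trans (late_hit_step c0 _ Ay) _.
  move=> z Az; apply: IH => //; rewrite leq_subRL -?mulSn//.
  by apply: leq_trans mN; rewrite mulSn leq_addr.
rewrite late_hit_exits_pr0//; last first.
  by apply: leq_trans mN; rewrite mulSn -addnA leq_addr.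
rewrite addr0 exprS; set v := ((bu + w) / a)%R.
have -> : (rho * w = rho * a * (w / a))%R by field; exact: lt0r_neq0.
by rewrite le_eqVlt; apply/orP; left; apply/eqP; ring.
Qed.

End upper.
End renewal.

(** * Hitting times *)

Section hitting_times.
Context {R : realType} {S : pmetricType R} {d : measure_display}
  {Omega : measurableType d}.
Variables (X : nat -> Omega -> S).
Implicit Types (E B I J A : set S) (w : Omega) (t : R).

Lemma hitting_time_leP E w t : (0 <= t)%R ->
  hitting_time X E w <= t%:E <->
  exists2 j, (j <= Num.truncn t)%N & E (X j w).
Proof.
move=> t0; split => [|[j jt Ej]]; last first.
  apply: (@le_trans _ _ j%:R%:E); first by apply: ereal_inf_lbound; exists j.
  by rewrite lee_fin -truncn_ge_nat.
apply: contraPP => nE; apply/negP; rewrite -ltNge.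
apply: (@lt_le_trans _ _ (Num.truncn t).+1%:R%:E).
  by rewrite lte_fin truncnS_gt.
apply: le_ereal_inf_tmp => _ [j Ej <-]; rewrite lee_fin ler_nat ltnNge.
by apply/negP => jt; apply: nE; exists j.
Qed.

Lemma hitting_time_gtP E w t : (0 <= t)%R ->
  t%:E < hitting_time X E w <->
  forall j, (j <= Num.truncn t)%N -> ~ E (X j w).
Proof.
move=> t0; split => [|H].
  rewrite ltNge => /negP tH j jt Ej; apply: tH.
  by apply/hitting_time_leP => //; exists j.
by rewrite ltNge; apply/negP => /(hitting_time_leP _ _ t0)[j /H].
Qed.

Lemma hitting_time_eqP E w (k : nat) : hitting_time X E w = k%:R%:E <->
  (forall i, (i < k)%N -> ~ E (X i w)) /\ E (X k w).
Proof.
split => [tk|[kE Ek]].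
  have := lexx (k%:R%:E : \bar R); rewrite -{1}tk => /hitting_time_leP[//|j].
  rewrite natrK => jk Ej.
  have kE i : (i < k)%N -> ~ E (X i w).
    move=> ik Ei; have : hitting_time X E w <= i%:R%:E.
      by apply/hitting_time_leP => //; exists i; rewrite ?natrK.
    by rewrite tk lee_fin ler_nat leqNgt ik.
  by split => //; move: jk Ej; rewrite leq_eqVlt => /predU1P[->//|/kE].
apply/eqP; rewrite eq_le; apply/andP; split.
  by apply/hitting_time_leP => //; exists k; rewrite ?natrK.
apply: le_ereal_inf_tmp => _ [j Ej <-]; rewrite lee_fin ler_nat leqNgt.
by apply/negP => /kE.
Qed.

End hitting_times.

(** * Hitting-time events as events on trajectories *)

Section hitting_events.
Context {R : realType} {S : pmetricType R} {d : measure_display}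
  {Omega : measurableType d}.
Variables (X : S -> nat -> Omega -> S) (y : S).
Implicit Types (E B I J A : set S) (t : R).

Lemma exit_event J B t : (0 <= t)%R ->
  [set w | hitting_time (X y) (~` J) w <= t%:E] `&`
    hit_location_in (X y) (~` J) B = pathwise X (exits J (Num.truncn t) B) y.
Proof.
move=> t0; apply/seteqP; split => w /=.
  move=> [+ [k kw Bk]]; rewrite kw lee_fin -truncn_ge_nat// => kt.
  move/hitting_time_eqP: kw => [kJ nJ]; exists k => //.
  by split => // i /kJ /contrapT.
move=> [k kt [kJ [Bk nJ]]].
have kw : hitting_time (X y) (~` J) w = k%:R%:E.
  by apply/hitting_time_eqP; split => // i /kJ Ji; apply.
by split; [rewrite kw lee_fin -truncn_ge_nat|exists k].
Qed.

Lemma stay_event D t : (0 <= t)%R ->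
  [set w | t%:E < hitting_time (X y) (~` D) w] =
  pathwise X (stay_then D (Num.truncn t) D) y.
Proof.
move=> t0; apply/seteqP; split => w /=.
  move/(hitting_time_gtP _ _ _ t0) => H.
  have jD j : (j <= Num.truncn t)%N -> D (X y j w) by move=> /H /contrapT.
  by split => [i /ltnW|]; exact: jD.
move=> [kD Dk]; apply/hitting_time_gtP => // j.
by rewrite leq_eqVlt => /predU1P[-> //|/kD jD]; apply.
Qed.

Lemma exits_disjoint_stay J n B :
  pathwise X (exits J n B) y `&` pathwise X (stay_then J n J) y = set0.
Proof.
rewrite -subset0 => w [wE [kJ Jk]]; apply: exits_not_stay wE => i.
by rewrite leq_eqVlt => /predU1P[->//|/kJ].
Qed.

Lemma late_hit_event I B (g t : R) : (0 < g)%R -> (0 <= t)%R -> B `<=` ~` I ->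
  [set w | t%:E < g%:E * hitting_time (X y) (~` I) w] `&`
    hit_location_in (X y) (~` I) B =
  pathwise X (late_hit I (Num.truncn (t / g)) B) y.
Proof.
move=> g0 t0 BI.
have kt k : (t < g * k%:R)%R = (Num.truncn (t / g) < k)%N.
  have tg0 : (0 <= t / g)%R by rewrite divr_ge0// ltW.
  by rewrite truncn_lt_nat// ltr_pdivrMr// mulrC.
apply/seteqP; split => w /=.
  move=> [+ [k kw Bk]]; rewrite kw -EFinM lte_fin kt => tk.
  move/hitting_time_eqP: kw => [kJ nJ]; exists k => //.
  by split => // i /kJ /contrapT.
move=> [k tk [kI Bk]].
have kw : hitting_time (X y) (~` I) w = k%:R%:E.
  by apply/hitting_time_eqP; split => [i /kI Ii|]; [apply|exact: BI].
by split; [rewrite kw -EFinM lte_fin kt|exists k].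
Qed.

Lemma scaled_hitting_time_le I (g t : R) : (0 < g)%R -> (0 <= t)%R ->
  [set w | g%:E * hitting_time (X y) (~` I) w <= t%:E] =
  ~` pathwise X (stay_then I (Num.truncn (t / g)) I) y.
Proof.
move=> g0 t0; rewrite -stay_event; last by rewrite divr_ge0// ltW.
have tE w : (g%:E * hitting_time (X y) (~` I) w <= t%:E) =
    ~~ ((t / g)%:E < hitting_time (X y) (~` I) w).
  by rewrite -leNgt EFinM lee_pdivlMr// muleC.
by apply/seteqP; split => w /=; rewrite tE => /negP.
Qed.

End hitting_events.

(** * Asymptotics *)

Section limf.
Context {R : realType}.
Implicit Types (f g : R -> \bar R) (F : set_system R) (a : \bar R).

Lemma limf_esup_lt_near f F a : Filter F -> limf_esup f F < a ->
  F [set x | f x < a].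
Proof.
move=> FF; rewrite limf_esupE => /ereal_inf_lt[_ [V FV <-] Va].
apply: filterS FV => x Vx; apply: le_lt_trans Va.
by apply: ereal_sup_ubound; exists x.
Qed.

Lemma limf_einf_gt_near f F a : Filter F -> a < limf_einf f F ->
  F [set x | a < f x].
Proof.
move=> FF; rewrite /limf_einf lteNr => /limf_esup_lt_near.
by apply: filterS => x; rewrite /= lteN2.
Qed.

Lemma limf_esup_le_near f F a : F [set x | f x <= a] ->
  limf_esup f F <= a.
Proof.
move=> Fa; rewrite limf_esupE; apply: ge_ereal_inf.
exists (ereal_sup (f @` [set x | f x <= a])); first by exists [set x | f x <= a].
by apply: ge_ereal_sup => _ [x xa <-].
Qed.

Lemma limf_einf_ge_near f F a : Filter F -> F [set x | a <= f x] ->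
  a <= limf_einf f F.
Proof.
move=> FF Fa; rewrite /limf_einf leeNr; apply: limf_esup_le_near.
by apply: filterS Fa => x; rewrite /= leeN2.
Qed.

Lemma limf_einf_le_esup f g F : ProperFilter F -> F [set x | f x <= g x] ->
  limf_einf f F <= limf_esup g F.
Proof.
move=> FF fg; rewrite limf_einfE limf_esupE; apply: ge_ereal_sup => _ [V FV <-].
apply: le_ereal_inf_tmp => _ [W FW <-].
have [x [/= fgx [Vx Wx]]] := filter_ex (filterI fg (filterI FV FW)).
apply: (@le_trans _ _ (f x)); first by apply: ereal_inf_lbound; exists x.
by apply: le_trans fgx _; apply: ereal_sup_ubound; exists x.
Qed.

Lemma ereal_sup_div_lt (S : set (\bar R)) (r a : R) x : (0 < r)%R ->
  ereal_sup S / r%:E < a%:E -> S x -> x <= (r * a)%:E.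
Proof.
move=> r0; rewrite inver gt_eqF// lte_pdivrMr// -EFinM mulrC => Sa Sx.
by apply: le_trans (ltW Sa); exact: ereal_sup_ubound.
Qed.

Lemma ereal_inf_div_gt (S : set (\bar R)) (r a : R) x : (0 < r)%R ->
  a%:E < ereal_inf S / r%:E -> S x -> (r * a)%:E <= x.
Proof.
move=> r0; rewrite inver gt_eqF// lte_pdivlMr// -EFinM mulrC => Sa Sx.
by apply: le_trans (ltW Sa) _; exact: ereal_inf_lbound.
Qed.

End limf.

(** The limit in [T] is taken first, so the threshold [M] depends on [e]. *)
Lemma iterated_lim0_near {R : realType} (delta : R -> R -> R) (k : R) :
  iterated_lim0 delta -> (0 < k)%R ->
  \forall e \near (0%R : R)^'+, exists M, forall T, (M < T)%R -> (delta e T < k)%R.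
Proof.
move=> [cd d0] k0.
have dk : \forall e \near (0%R : R)^'+, ((lim (delta e T @[T --> +oo%R]) : R) < k)%R.
  exact: (cvgr_lt 0%R).
near=> e.
have ce : cvg (delta e T @[T --> +oo%R]) by near: e.
have lk : ((lim (delta e T @[T --> +oo%R]) : R) < k)%R by near: e.
have [M [_ HM]] : \forall T \near +oo%R, (delta e T < k)%R by exact: (cvgr_lt _ ce).
by exists M.
Unshelve. all: by end_near. Qed.

(** [T0 <= k * T] makes the waiting phase short compared with the running phase; [s] lists the
    thresholds that the horizon must exceed. *)
Lemma exists_horizon {R : realType} (k T0 : R) (s : seq R) : (0 < k)%R ->
  exists T, [/\ (0 < T)%R, (T0 <= k * T)%R & {in s, forall M, (M < T)%R}].
Proof.
move=> k0; have sT : \forall T \near +oo%R, {in s, forall M, (M < T)%R}.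
  elim: s => [|M s IH]; first by apply: nearW.
  near=> T => N; rewrite inE => /predU1P[->|Ns].
    by near: T; apply: nbhs_pinfty_gt; rewrite num_real.
  suff sT : {in s, forall M, (M < T)%R} by exact: sT.
  by near: T.
near (+oo%R : set_system R) => T; exists T; split.
- by near: T; apply: nbhs_pinfty_gt; rewrite num_real.
- rewrite mulrC -ler_pdivrMr//; near: T; by apply: nbhs_pinfty_ge; rewrite num_real.
- by near: T.
Unshelve. all: by end_near. Qed.

Lemma cvg_small {R : realType} (f : R -> R) (a eps : R) : f k @[k --> (0%R : R)^'+] --> a ->
  (0 < eps)%R -> exists k, [/\ (0 < k)%R, (2 * k < 1)%R & (`|a - f k| <= eps)%R].
Proof.
move=> fa eps0; near ((0%R : R)^'+) => k; exists k; split.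
- by near: k; exact: nbhs_right_gt.
- rewrite mulrC -ltr_pdivlMr//; near: k; apply: nbhs_right_lt; exact: divr_gt0.
- near: k; exact: (cvgrPdist_le _ _).1.
Unshelve. all: by end_near. Qed.

(** * Exponential bounds and the number of cycles *)

Section asymptotics.
Context {R : realType}.
Implicit Types (q k t g eta T b c : R) (N : nat).

Lemma pow_le_expR q N : (0 <= 1 - q)%R -> ((1 - q) ^+ N <= expR (- (q * N%:R)))%R.
Proof.
move=> q0; rewrite -mulNr mulrC expRM_natl.
by apply: lerXn2r; rewrite ?nnegrE ?expR_ge0//; exact: expR_ge1Dx.
Qed.

(** Converse of the previous bound at the price of a factor [1 + k] in the exponent: [1 / (1 - q) <=
    1 + q * (1 + k) <= expR (q * (1 + k))], the first inequality being the smallness of [q]. *)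
Lemma expR_le_pow q k N : (0 <= q)%R -> (q < 1)%R -> (q * (1 + k) <= k)%R ->
  (expR (- (q * (1 + k) * N%:R)) <= (1 - q) ^+ N)%R.
Proof.
move=> q0 q1 qk; rewrite -mulNr mulrC expRM_natl.
apply: lerXn2r; rewrite ?nnegrE ?expR_ge0 ?subr_ge0 ?(ltW q1)//.
rewrite expRN -[leRHS]invrK lef_pV2 ?posrE ?expR_gt0 ?invr_gt0 ?subr_gt0//.
apply: le_trans (expR_ge1Dx _); rewrite -[leLHS]mul1r ler_pdivrMr ?subr_gt0//.
have -> : ((1 + q * (1 + k)) * (1 - q) = 1 + q * (k - q * (1 + k)))%R by ring.
by rewrite lerDl mulr_ge0// subr_ge0.
Qed.

Section counts.
Variables (eta T T0 g t k : R).
Hypotheses (eta0 : (0 < eta)%R) (T0_gt0 : (0 < T0)%R) (g0 : (0 < g)%R) (t0 : (0 <= t)%R)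
  (k0 : (0 < k)%R) (k1 : (k < 1)%R) (Tp : (0 < T)%R) (T0k : (T0 <= k * T)%R).
Let l := Num.truncn (T / eta).
Let n := Num.truncn (T0 / eta).
Let m := Num.truncn (t / g).
Local Notation rho := (g * T / eta)%R.

Let Te : (0 < T / eta)%R. Proof. by rewrite divr_gt0. Qed.
Let rhoE : (rho = g * (T / eta))%R. Proof. by rewrite mulrA. Qed.
Let lT : (l%:R <= T / eta < l%:R + 1)%R.
Proof. by rewrite natr1; apply: truncn_itv; exact: ltW. Qed.
Let nT : (n%:R <= k * (T / eta))%R.
Proof.
apply: (@le_trans _ _ (T0 / eta)%R); first by rewrite truncn_le divr_ge0// ltW.
by rewrite mulrA ler_pM2r// invr_gt0.
Qed.
Let mt : (m%:R <= t / g < m%:R + 1)%R.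
Proof. by rewrite natr1; apply: truncn_itv; rewrite divr_ge0// ltW. Qed.

(** Counts cycles of maximal length [l + n] in the [m - n] steps left after an initial phase of at
    most [n] steps. Since [l + n <= (1 + k) * (T / eta)], rounding and the initial phase cost at
    most [2 * rho + 2 * k * rho <= 4 * rho]. *)
Lemma count_upper : (eta <= T)%R -> (4 * rho <= k)%R ->
  exists2 N, (N * (l + n) <= m - n)%N & ((t - k) / (1 + k) <= N%:R * rho)%R.
Proof.
move=> etaT rhok; exists ((m - n) %/ (l + n))%N; first exact: leq_trunc_div.
have l0 : (0 < l)%N by rewrite truncn_gt0 ler_pdivlMr// mul1r.
set N := (_ %/ _)%N.
have mN : (m <= N.+1 * (l + n) + n)%N.
  have ln0 : (0 < l + n)%N by rewrite addn_gt0 l0.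
  by rewrite addnC -leq_subLR ltnW// ltn_ceil.
have mN' : (m%:R <= (N%:R + 1) * (l%:R + n%:R) + n%:R :> R)%R.
  by rewrite natr1 -natrD -natrM -natrD ler_nat.
have N0 : (0 <= N%:R :> R)%R by [].
rewrite ler_pdivrMr; last by rewrite addr_gt0.
have [/andP[_ tm] /andP[lT' _]] := (mt, lT).
have {}tm : (t <= g * (m%:R + 1))%R by move: tm; rewrite ltr_pdivrMr// mulrC => /ltW.
have [Te' rhoE' nT'] := And3 Te rhoE nT.
set X := (T / eta)%R in Te' rhoE' lT' nT' *.
have H1 : (m%:R <= (N%:R + 1) * (X + k * X) + k * X)%R.
  apply: le_trans mN' _; apply: lerD => //; apply: ler_wpM2l; first exact: addr_ge0.
  exact: lerD.
have X1 : (1 <= X)%R by rewrite ler_pdivlMr// mul1r.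
have H2 : (t <= g * ((N%:R + 1) * (X + k * X) + k * X + X))%R.
  by apply: le_trans tm _; rewrite ler_pM2l//; apply: lerD.
have kr : (k * (g * X) <= g * X)%R by apply: ler_piMl; [apply: mulr_ge0|]; exact: ltW.
rewrite rhoE' in rhok *.
have -> : (N%:R * (g * X) * (1 + k) = g * ((N%:R + 1) * (X + k * X) + k * X + X)
   - (2 * (k * (g * X)) + 2 * (g * X)))%R by ring.
by move: H2 kr rhok; set Y := (g * (_ + _))%R; set Z := (g * X)%R; lra.
Qed.

(** Counts cycles of minimal length [l], rounded up. By [eta <= k * T] the rounding of [l] is at
    most [k * (T / eta)], so [l >= (1 - k) * (T / eta)]; the extra cycle costs at most
    [rho <= k]. *)
Lemma count_lower : (eta <= k * T)%R -> (rho <= k)%R ->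
  exists2 N, (m <= N * l)%N & (N%:R * ((1 - k) * rho) <= t + k)%R.
Proof.
move=> etaT rhok; exists (m %/ l).+1.
  have l0 : (0 < l)%N.
    by rewrite truncn_gt0 ler_pdivlMr// mul1r (le_trans etaT)// ler_piMl// ltW.
  by apply: ltnW; exact: ltn_ceil.
set N := (m %/ l)%N.
have mN' : (N%:R * l%:R <= m%:R :> R)%R by rewrite -natrM ler_nat leq_trunc_div.
have [/andP[tm _] /andP[_ lT']] := (mt, lT).
have {}tm : (g * m%:R <= t)%R by move: tm; rewrite ler_pdivlMr// mulrC.
have [Te' rhoE'] := conj Te rhoE.
set X := (T / eta)%R in Te' rhoE' lT' *.
have X1 : (1 <= k * X)%R by rewrite mulrA ler_pdivlMr// mul1r.
have N0 : (0 <= N%:R :> R)%R by [].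
have H1 : (N%:R * ((1 - k) * X) <= m%:R)%R.
  by apply: le_trans mN'; apply: ler_wpM2l => //; lra.
have H2 : (g * (N%:R * ((1 - k) * X)) <= t)%R by apply: le_trans tm; rewrite ler_pM2l.
rewrite rhoE' in rhok *; rewrite -natr1.
have kr : (0 <= k * (g * X))%R by apply: mulr_ge0; [|apply: mulr_ge0]; exact: ltW.
have -> : ((N%:R + 1) * ((1 - k) * (g * X)) =
  g * (N%:R * ((1 - k) * X)) + (g * X - k * (g * X)))%R by ring.
by move: H2 rhok kr; set Y := (g * (_ * _))%R; set Z := (g * X)%R; lra.
Qed.

End counts.

(* At [k = 0] these are [b * expR (- t)] and [expR (- (c * t))]: [a] bounds the exit
   probability of a cycle from below, [w] the probability that a cycle goes wrong,
   [cycle_loss] the probability that it does not end in [A], all in units of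
   [rho], and [2 * k] is the cost of the initial phase. *)
Definition upper_bound_fun b t k :=
  let a := (1 - k)%R in
  let w := (k + ((1 + k) * (1 + k) - a) + k)%R in
  (w / a + expR (- (a * ((t - k) / (1 + k)))) * ((b + k + w) / a) + 2 * k)%R.

Definition cycle_loss c k := ((1 + k) * (c + k) + k)%R.

Definition lower_bound_fun (th : R -> R) t k :=
  (expR (- (th k * (1 + k) * ((t + k) / (1 - k)))) * (1 - 2 * k))%R.

Lemma cvg_upper_bound b t :
  upper_bound_fun b t k @[k --> (0%R : R)^'+] --> (b * expR (- t))%R.
Proof.
apply: cvg_at_right_filter.
have -> : (b * expR (- t) = upper_bound_fun b t 0)%R.
  by rewrite /upper_bound_fun !(addr0, subr0, mulr0, mulr1, divr1, subrr, add0r, mul1r) mulrC.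
have n1 : (1 - 0 != 0 :> R)%R by rewrite subr0 oner_eq0.
have n2 : (1 + 0 != 0 :> R)%R by rewrite addr0 oner_eq0.
have ck : (k @[k --> (0%R : R)] --> (0%R : R))%R by exact: cvg_id.
have cc (c : R) : (c @[_ --> (0%R : R)] --> c)%R by exact: cvg_cst.
have ca : ((1 - k) @[k --> (0%R : R)] --> (1 - 0 : R))%R by exact: cvgB.
have cs : ((1 + k) @[k --> (0%R : R)] --> (1 + 0 : R))%R by exact: cvgD.
have cw : ((k + ((1 + k) * (1 + k) - (1 - k)) + k) @[k --> (0%R : R)] -->
    (0 + ((1 + 0) * (1 + 0) - (1 - 0)) + 0 : R))%R.
  by apply: cvgD => //; apply: cvgD => //; apply: cvgB => //; exact: cvgM.
have cE : ((- ((1 - k) * ((t - k) / (1 + k)))) @[k --> (0%R : R)] -->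
    (- ((1 - 0) * ((t - 0) / (1 + 0))) : R))%R.
  by apply: cvgN; apply: cvgM => //; apply: cvgM; [exact: cvgB|exact: cvgV].
have cexp : (expR (- ((1 - k) * ((t - k) / (1 + k)))) @[k --> (0%R : R)] -->
    expR (- ((1 - 0) * ((t - 0) / (1 + 0))) : R))%R.
  by apply: continuous_cvg cE; exact: continuous_expR.
have cV : ((1 - k)^-1 @[k --> (0%R : R)] --> ((1 - 0)^-1 : R))%R by exact: cvgV.
apply: cvgD; last exact: cvgM.
apply: cvgD; first exact: cvgM.
apply: cvgM => //; apply: cvgM => //; apply: cvgD => //; exact: cvgD.
Qed.

Lemma cvg_lower_bound (th : R -> R) t : {for 0%R, continuous th} ->
  lower_bound_fun th t k @[k --> (0%R : R)^'+] --> (expR (- (th 0 * t)) : R)%R.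
Proof.
move=> cth; apply: cvg_at_right_filter.
have -> : (expR (- (th 0 * t)) = lower_bound_fun th t 0)%R.
  by rewrite /lower_bound_fun !(addr0, subr0, mulr0, mulr1, divr1).
have n1 : (1 - 0 != 0 :> R)%R by rewrite subr0 oner_eq0.
have ck : (k @[k --> (0%R : R)] --> (0%R : R))%R by exact: cvg_id.
have cc (c : R) : (c @[_ --> (0%R : R)] --> c)%R by exact: cvg_cst.
have cs : ((1 + k) @[k --> (0%R : R)] --> (1 + 0 : R))%R by exact: cvgD.
have ca : ((1 - k)^-1 @[k --> (0%R : R)] --> ((1 - 0)^-1 : R))%R.
  by apply: cvgV => //; exact: cvgB.
have cE : ((- (th k * (1 + k) * ((t + k) / (1 - k)))) @[k --> (0%R : R)] -->
    (- (th 0 * (1 + 0) * ((t + 0) / (1 - 0))) : R))%R.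
  by apply: cvgN; apply: cvgM; [exact: cvgM|apply: cvgM => //; exact: cvgD].
apply: cvgM; first by apply: continuous_cvg cE; exact: continuous_expR.
by apply: cvgB => //; exact: cvgM.
Qed.

End asymptotics.

Section estimates.
Context {R : realType} {S : pmetricType R} {d : measure_display}
  {Omega : measurableType d}.

(* [rho] is gamma(eta) T / eta and [k] collects all error terms; [l] and [n] are
   the lengths of the running and of the waiting phase of a cycle. *)
Record renewal_estimates (P : probability Omega R) (X : S -> nat -> Omega -> S)
    (I J A B : set S) (l n : nat) (rho k c bl bu : R) : Prop := {
  exitB_ge_rho : forall y, A y -> (rho * bl <= fine (P (pathwise X (exits J l B) y)))%R ;
  exitB_le_rho : forall y, A y -> (fine (P (pathwise X (exits J l B) y)) <= rho * bu)%R ;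
  exitT_ge_rho : forall y, A y ->
    (rho * (c - k) <= fine (P (pathwise X (exits J l setT) y)))%R ;
  exitT_le_rho : forall y, A y ->
    (fine (P (pathwise X (exits J (l + n) setT) y)) <= rho * ((1 + k) * (c + k)))%R ;
  exitI_le_rho : forall y, A y -> (fine (P (pathwise X (exits J l I) y)) <= rho * k)%R ;
  avoid_le_rho : forall y, J y ->
    (fine (P (pathwise X (stay_then (J `\` A) n (J `\` A)) y)) <= rho * k)%R ;
  start_ge : forall y, J y ->
    (1 - 2 * k <= fine (P (\bigcup_j pathwise X (regen I A 0 n j) y)))%R }.

End estimates.

(** * Bounds for one fixed [eta] *)

Section chain_bounds.
Context {R : realType} {S : pmetricType R} {d : measure_display}
  {Omega : measurableType d}.
Variables (P : probability Omega R) (K : R.-pker (Borel S) ~> (Borel S))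
  (X : S -> nat -> Omega -> S).
Hypothesis hX : forall x, markov_chain P K x (X x).
Variables (I J A B : set (Borel S)).
Hypotheses (mI : measurable I) (mJ : measurable J) (mA : measurable A)
  (mB : measurable B) (JI : J `<=` I) (AI : A `<=` I).
Variables (eta T T0 g t k c bl bu : R).
Hypotheses (eta0 : (0 < eta)%R) (T0_gt0 : (0 < T0)%R) (g0 : (0 < g)%R) (t0 : (0 <= t)%R)
  (k0 : (0 < k)%R) (k1 : (2 * k < 1)%R) (Tp : (0 < T)%R) (T0k : (T0 <= k * T)%R).
Local Notation l := (Num.truncn (T / eta)).
Local Notation n := (Num.truncn (T0 / eta)).
Local Notation m := (Num.truncn (t / g)).
Local Notation rho := (g * T / eta)%R.
Local Notation pr Phi y := (fine (P (pathwise X Phi y))).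
Hypothesis est : renewal_estimates P X I J A B l n rho k c bl bu.

Let k_lt1 : (k < 1)%R. Proof. by move: k0 k1; lra. Qed.
Let rho0 : (0 < rho)%R. Proof. by rewrite divr_gt0// mulr_gt0. Qed.

(** The initial phase is a cycle with [l = 0] and [J = I]: it reaches [A] within [n] steps up to
    probability [2 * k], and the iterated bound applies at the threshold [m - n]. *)
Lemma late_hit_upper b y : c = 1%R -> bu = (b + k)%R -> (0 <= b)%R ->
  B `<=` ~` I -> (eta <= T)%R -> (4 * rho <= k)%R -> J y ->
  (pr (late_hit I m B) y <= upper_bound_fun b t k)%R.
Proof.
move=> c1 buE b0 BI etaT rhok Jy; subst c bu.
have [N Nmn Nrho] := count_upper eta0 T0_gt0 g0 t0 k0 k_lt1 Tp T0k etaT rhok.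
rewrite /upper_bound_fun; set a := (1 - k)%R.
set w := (k + ((1 + k) * (1 + k) - a) + k)%R; set E := expR _.
have a0 : (0 < a)%R by rewrite subr_gt0.
have w0 : (0 <= w)%R.
  have : (0 <= k * k)%R by rewrite mulr_ge0// ltW.
  by rewrite /w /a; move: k0; lra.
have E0 : (0 < E)%R := expR_gt0 _.
have v0 : (0 <= (b + k + w) / a)%R.
  by apply: divr_ge0; [apply: addr_ge0 => //; apply: addr_ge0 => //|]; exact: ltW.
have late_le z : A z -> (pr (late_hit I (m - (0 + n)) B) z <= w / a + E * ((b + k + w) / a))%R.
  move=> Az; apply: le_trans (late_hit_le_pow hX mI mJ mA JI rho0 (ltW k0)
    (exitT_le_rho est) (avoid_le_rho est) mB BI a0 (exitB_le_rho est)
    (exitT_ge_rho est) (exitI_le_rho est) w0 Nmn Az) _.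
  rewrite lerD2l; apply: ler_wpM2r => //.
  apply: le_trans (pow_le_expR _ _) _.
    rewrite subr_ge0; apply: (@le_trans _ _ (rho * 1)%R).
      by rewrite ler_pM2l// lerBlDr lerDl ltW.
    by move: rhok k1; rewrite mulr1; lra.
  rewrite ler_expR lerN2 [leRHS](_ : _ = a * (N%:R * rho))%R; last by ring.
  by rewrite ler_pM2l.
apply: le_trans (late_hit_le_returns hX mI mI mA mB (@subset_refl _ _) BI y _ late_le) _.
  by apply: addr_ge0; [apply: divr_ge0 => //|apply: mulr_ge0 => //]; exact: ltW.
by rewrite lerD2l; have := start_ge est Jy; lra.
Qed.

Let expR_le_rho_pow : (0 <= c)%R -> (eta <= k * T)%R -> (rho <= k)%R ->
  (rho * cycle_loss c k * (1 + k) <= k)%R -> exists N, [/\ (m <= N * l)%N,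
    (expR (- (cycle_loss c k * (1 + k) * ((t + k) / (1 - k)))) <=
      (1 - rho * cycle_loss c k) ^+ N)%R &
    (0 <= 1 - rho * cycle_loss c k)%R].
Proof.
move=> c0 etaT rhok rth; have [N Nm Nrho] := count_lower eta0 g0 t0 k0 k_lt1 Tp etaT rhok.
have kp : (0 < 1 + k)%R by rewrite addr_gt0.
have km : (0 < 1 - k)%R by rewrite subr_gt0.
have th0 : (0 <= cycle_loss c k)%R.
  by apply: addr_ge0; [apply: mulr_ge0; [|apply: addr_ge0 => //]|]; exact: ltW.
have rth0 : (0 <= rho * cycle_loss c k)%R by apply: mulr_ge0 => //; exact: ltW.
have rth1 : (rho * cycle_loss c k < 1)%R.
  by rewrite -(ltr_pM2r kp) mul1r (le_lt_trans rth)// ltrDr.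
exists N; split => //; last by rewrite subr_ge0 ltW.
apply: le_trans (expR_le_pow N rth0 rth1 rth).
rewrite ler_expR lerN2 [leLHS](_ : _ = cycle_loss c k * (1 + k) * (N%:R * rho))%R; last by ring.
apply: ler_wpM2l; first by apply: mulr_ge0 => //; exact: ltW.
by rewrite ler_pdivlMr// mulrAC -mulrA.
Qed.

Lemma late_hit_lower y : (0 <= c)%R -> (0 <= bl)%R -> B `<=` ~` I ->
  (eta <= k * T)%R -> (rho <= k)%R -> (rho * cycle_loss c k * (1 + k) <= k)%R -> J y ->
  (lower_bound_fun (cycle_loss c) t k * (bl / cycle_loss c k) <= pr (late_hit I m B) y)%R.
Proof.
move=> c0 bl0 BI etaT rhok rth Jy.
have [N [Nm NE N0]] := expR_le_rho_pow c0 etaT rhok rth.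
have th0 : (0 < cycle_loss c k)%R.
  by apply: ltr_wpDl => //; apply: mulr_ge0; apply: addr_ge0 => //; exact: ltW.
rewrite /lower_bound_fun; set E := expR _ in NE *.
have E0 : (0 <= E)%R := expR_ge0 _.
have b0 : (0 <= bl / cycle_loss c k)%R by apply: divr_ge0 => //; exact: ltW.
(* The initial phase only delays the exit, so the threshold stays [m]. *)
have late_ge z : A z -> (E * (bl / cycle_loss c k) <= pr (late_hit I (m - 0) B) z)%R.
  move=> Az; rewrite subn0.
  apply: le_trans (late_hit_ge_pow hX mI mJ mA JI AI rho0 (ltW k0)
    (exitT_le_rho est) (avoid_le_rho est) mB BI (exitB_ge_rho est) th0 bl0 N0 Nm Az).
  exact: ler_wpM2r.
apply: le_trans (late_hit_ge_returns hX n mI mI mA mB (@subset_refl _ _) BI y _ late_ge).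
  rewrite mulrAC; apply: ler_wpM2l; first exact: mulr_ge0.
  exact: (start_ge est).
exact: mulr_ge0.
Qed.

Lemma stay_lower y : (0 <= c)%R ->
  (eta <= k * T)%R -> (rho <= k)%R -> (rho * cycle_loss c k * (1 + k) <= k)%R -> J y ->
  (lower_bound_fun (cycle_loss c) t k <= pr (stay_then I m I) y)%R.
Proof.
move=> c0 etaT rhok rth Jy.
have [N [Nm NE N0]] := expR_le_rho_pow c0 etaT rhok rth.
rewrite /lower_bound_fun; set E := expR _ in NE *.
have E0 : (0 <= E)%R := expR_ge0 _.
have stay_ge z : A z -> (E <= pr (stay_then I (m - 0) I) z)%R.
  move=> Az; rewrite subn0; apply: le_trans NE _.
  exact: (stay_ge_pow hX mI mJ mA JI AI rho0 (ltW k0) (exitT_le_rho est) (avoid_le_rho est)).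
apply: le_trans (stay_ge_returns hX n mI mI mA (@subset_refl _ _) y E0 stay_ge).
by apply: ler_wpM2l => //; exact: (start_ge est).
Qed.

End chain_bounds.

(** * From the asymptotic atom to the exit law *)

Section borel.
Context {R : realType} {S : pmetricType R}.

Lemma borel_open (U : set S) : open U -> measurable (U : set (Borel S)).
Proof. by move=> oU; exact: sub_sigma_algebra. Qed.

Lemma borel_closure (B : set S) : measurable (closure B : set (Borel S)).
Proof.
rewrite -[X in measurable X]setCK; apply: measurableC; apply: borel_open.
exact/closed_openC/closed_closure.
Qed.

Lemma borel_interior (B : set S) : measurable (interior B : set (Borel S)).
Proof. by apply: borel_open; exact: open_interior. Qed.

End borel.

Section asymptotic_atom_bounds.
Context {R : realType} {S : pmetricType R} {d : measure_display}
  {Omega : measurableType d}.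
Variables (P : probability Omega R) (V : R -> nat -> S -> Omega -> S)
  (I : set S) (C : {measure set (Borel S) -> \bar R})
  (gamma : R -> R) (Icov A : R -> set S).
Hypotheses (hV : markov_family P V)
    (hI : measurable (I : set (Borel S)))
    (hC : location_measure I C)
    (hcov : covering I Icov)
    (hattr : asymptotic_domain_of_attraction P V I Icov)
    (hatom : asymptotic_atom P V I C gamma Icov A).

Local Notation chain eta := (fun (x : S) j => V eta j x).

Lemma chain_markov eta : (0 < eta)%R ->
  exists K : R.-pker (Borel S) ~> (Borel S), forall x, markov_chain P K x (chain eta x).
Proof. by move=> eta0; exact: hV. Qed.

(** [closure I] is covered by [I] and its boundary, both null. In the atom property for the set [I]
    this makes exits from [I(eps)] that land in [I] negligible. *)
Lemma location_closure0 : C (closure I) = 0.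
Proof.
have [CI CdI] := hC; apply/eqP; rewrite eq_le measure_ge0 andbT.
have mD : measurable (closure I `\` interior I : set (Borel S)).
  by apply: measurableD; [exact: borel_closure|exact: borel_interior].
apply: (@le_trans _ _ (C (I `|` (closure I `\` interior I)))).
  apply: le_measure; rewrite ?inE; [exact: borel_closure|exact: measurableU|].
  move=> x cx; have [/interior_subset|] := pselect (interior I x); first by left.
  by right.
by have := measureU2 C hI mD; rewrite [X in X + _]CI [X in _ + X]CdI adde0.
Qed.

Lemma locationT : C setT = C (~` I).
Proof.
have [CI _] := hC; have := measureU C hI (measurableC hI) (setICr I).
by rewrite setUv [X in X + _]CI add0e.
Qed.

Let Af e : (0 < e)%R -> measurable (A e : set (Borel S)) /\ A e `<=` I.
Proof. by have [[HA _] _ _ _] := hatom; exact: HA. Qed.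

Let Jf e : (0 < e)%R -> measurable (Icov e : set (Borel S)) /\ Icov e `<=` I.
Proof. by have [HJ _ _] := hcov; exact: HJ. Qed.

Let mT : measurable (setT : set (Borel S)). Proof. exact: measurableT. Qed.

Lemma gamma_gt0 eta : (0 < eta)%R -> (0 < gamma eta)%R.
Proof. by have [_ g0 _ _] := hatom; exact: g0. Qed.

(** Asymptotic attraction gives no exit from [I] within [T / eta] steps up to probability [k], and
    the atom property gives a visit to [A e] in the same time up to [k]; the two failures add up to
    [2 * k]. *)
Lemma start_ge_near e T k : (0 < e)%R -> (0 < T)%R -> (0 < k)%R ->
  limf_einf (fun eta : R =>
    ereal_inf [set P [set w | hitting_time (chain eta x) (A e) w <= (T / eta)%:E]
      | x in Icov e]) (0%R : R)^'+ = 1 ->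
  \forall eta \near (0%R : R)^'+, forall y, Icov e y ->
    (1 - 2 * k <= fine (P (\bigcup_j
      pathwise (chain eta) (regen I (A e) 0 (Num.truncn (T / eta)) j) y)))%R.
Proof.
move=> e0 T0 k0 hitA; have [mA AI] := Af e0; have [mJ JI] := Jf e0.
have near_hit : \forall eta \near (0%R : R)^'+, (1 - k)%:E < ereal_inf
    [set P [set w | hitting_time (chain eta x) (A e) w <= (T / eta)%:E] | x in Icov e].
  by apply: limf_einf_gt_near; rewrite hitA lte_fin; move: k0; lra.
have near_stay : \forall eta \near (0%R : R)^'+, (1 - k)%:E < ereal_inf
    [set P [set w | forall t : R, (0 <= t <= T)%R ->
             I (V eta (Num.truncn (t / eta)) x w)] | x in Icov e].
  apply: limf_einf_gt_near; apply: lt_le_trans (hattr e0 T0).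
  by rewrite lte_fin; move: k0; lra.
have near0 : \forall eta \near (0%R : R)^'+, (0 < eta)%R by exact: nbhs_right_gt.
near=> eta => y Jy.
have eta0 : (0 < eta)%R by near: eta.
have [K hK] := chain_markov eta0.
have Teta : (0 <= T / eta)%R by rewrite divr_ge0// ltW.
set n := Num.truncn (T / eta).
have mIA : measurable (I `\` A e : set (Borel S)) by exact: measurableD.
have mAC : measurable (~` A e : set (Borel S)) by exact: measurableC.
have mS D : measurable (D : set (Borel S)) ->
    measurable (pathwise (chain eta) (stay_then D n D) y).
  move=> mD; apply: (measurable_pathwise y).
  exact: (has_markov_property_stay_then hK).
have mE := measurable_exits hK n y hI mT.
apply: le_trans (returns_ge0 hK n hI mA y erefl).
have stayI : (1 - k < fine (P (pathwise (chain eta) (stay_then I n I) y)))%R.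
  rewrite -lte_fin fine_probabilityK; last exact: mS.
  suff : (1 - k)%:E < ereal_inf [set P [set w | forall t : R, (0 <= t <= T)%R ->
             I (V eta (Num.truncn (t / eta)) x w)] | x in Icov e].
    move/lt_le_trans; apply; apply: ereal_inf_lbound; exists y => //.
    (* The step [i <= n] is the time [i * eta] of [[0, T]], and each time [t] of [[0, T]] falls on a
       step at most [n]. *)
    congr (P _); apply/seteqP; split => w /=.
      move=> H; have nI i : (i <= n)%N -> I (V eta i y w).
        move=> iN; rewrite truncn_ge_nat// in iN.
        have := H (i%:R * eta)%R; rewrite mulfK ?gt_eqF// natrK; apply.
        by apply/andP; split; [rewrite mulr_ge0// ltW|rewrite -ler_pdivlMr].
      by split => [i /ltnW|]; exact: nI.
    move=> [sI nI] t /andP[t0 tT].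
    have : (Num.truncn (t / eta) <= n)%N.
      by apply: le_truncn; rewrite ler_pM2r// invr_gt0.
    by rewrite leq_eqVlt => /predU1P[->|/sI].
  by near: eta.
have hit : (1 - k < fine (P (~` pathwise (chain eta) (stay_then (~` A e) n (~` A e)) y)))%R.
  rewrite -lte_fin fine_probabilityK; last by apply: measurableC; exact: mS.
  rewrite -(stay_event (chain eta) y (~` A e) Teta) setCK.
  suff : (1 - k)%:E < ereal_inf
    [set P [set w | hitting_time (chain eta x) (A e) w <= (T / eta)%:E] | x in Icov e].
    move/lt_le_trans; apply; apply: ereal_inf_lbound; exists y => //.
    by congr (P _); apply/seteqP; split => w /=; rewrite leNgt => /negP.
  by near: eta.
have e1 : (fine (P (pathwise (chain eta) (exits I n setT) y)) +
    fine (P (pathwise (chain eta) (stay_then I n I) y)) <= 1)%R.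
  rewrite -fine_probabilityU_disjoint//; [|exact: mS|exact: exits_disjoint_stay].
  by apply: fine_probability_le1; apply: measurableU => //; exact: mS.
have e2 : (fine (P (pathwise (chain eta) (stay_then (I `\` A e) n (I `\` A e)) y)) +
    fine (P (~` pathwise (chain eta) (stay_then (~` A e) n (~` A e)) y)) <= 1)%R.
  have mC : measurable (~` pathwise (chain eta) (stay_then (~` A e) n (~` A e)) y).
    by apply: measurableC; exact: mS.
  rewrite -fine_probabilityU_disjoint//; last 2 first.
  - exact: mS.
  - by rewrite -subset0 => w [[sIA [_ nA]] /=]; apply; split => // i /sIA[].
  by apply: fine_probability_le1; apply: measurableU => //; exact: mS.
by move: stayI hit e1 e2; lra.
Unshelve. all: by end_near. Qed.

(** The slack [dl < k] makes the inequalities on the lower and upper limits strict, so they become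
    bounds valid for all small [eta], uniformly over [A e]. *)
Lemma exit_near e T (D : set S) (dl k : R) : (0 < e)%R -> (0 < T)%R ->
  measurable (D : set (Borel S)) -> (dl < k)%R ->
  C setT \is a fin_num ->
  let exit_in eta x :=
    P ([set w | hitting_time (chain eta x) (~` Icov e) w <= (T / eta)%:E] `&`
       hit_location_in (chain eta x) (~` Icov e) D) in
  let norm eta : \bar R := (gamma eta * T / eta)%:E in
  C (interior D) - dl%:E <= limf_einf (fun eta : R =>
    ereal_inf [set exit_in eta x | x in A e] / norm eta) (0%R : R)^'+ ->
  limf_esup (fun eta : R =>
    ereal_sup [set exit_in eta x | x in A e] / norm eta) (0%R : R)^'+ <=
    C (closure D) + dl%:E ->
  \forall eta \near (0%R : R)^'+, forall y, A e y ->
    (gamma eta * T / eta * (fine (C (interior D)) - k) <=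
      fine (P (pathwise (chain eta) (exits (Icov e) (Num.truncn (T / eta)) D) y)) <=
    gamma eta * T / eta * (fine (C (closure D)) + k))%R.
Proof.
move=> e0 T0 mD dlk Cfin exit_in norm hinf hsup.
have [mJ JI] := Jf e0.
have Cf (E : set S) : measurable (E : set (Borel S)) -> (fine (C E))%:E = C E.
  move=> mE; rewrite fineK// ge0_fin_numE ?measure_ge0//.
  apply: le_lt_trans (_ : C setT < +oo); last by rewrite -ge0_fin_numE ?measure_ge0.
  by apply: le_measure; rewrite ?inE.
have near0 : \forall eta \near (0%R : R)^'+, (0 < eta)%R by exact: nbhs_right_gt.
have nearinf : \forall eta \near (0%R : R)^'+, (fine (C (interior D)) - k)%:E <
    ereal_inf [set exit_in eta x | x in A e] / norm eta.
  apply: limf_einf_gt_near; apply: lt_le_trans hinf.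
  by rewrite -Cf ?lte_fin ?ltrD2l ?ltrN2//; exact: borel_interior.
have nearsup : \forall eta \near (0%R : R)^'+,
    ereal_sup [set exit_in eta x | x in A e] / norm eta < (fine (C (closure D)) + k)%:E.
  apply: limf_esup_lt_near; apply: le_lt_trans hsup _.
  by rewrite -Cf ?lte_fin ?ltrD2l//; exact: borel_closure.
near=> eta => y Ay.
have eta0 : (0 < eta)%R by near: eta.
have [K hK] := chain_markov eta0.
have Teta : (0 <= T / eta)%R by rewrite divr_ge0// ltW.
have norm0 : (0 < gamma eta * T / eta)%R by rewrite divr_gt0// mulr_gt0// gamma_gt0.
have exitE : exit_in eta y =
    (fine (P (pathwise (chain eta) (exits (Icov e) (Num.truncn (T / eta)) D) y)))%:E.
  rewrite /exit_in (exit_event (chain eta) y (Icov e) D Teta) fine_probabilityK//.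
  exact: (measurable_exits hK).
rewrite -!lee_fin -exitE; apply/andP; split.
  have : (fine (C (interior D)) - k)%:E <
    ereal_inf [set exit_in eta x | x in A e] / norm eta by near: eta.
  by move/(ereal_inf_div_gt norm0); apply; exists y.
have : ereal_sup [set exit_in eta x | x in A e] / norm eta <
  (fine (C (closure D)) + k)%:E by near: eta.
by move/(ereal_sup_div_lt norm0); apply; exists y.
Unshelve. all: by end_near. Qed.

Lemma avoid_near e T k : (0 < e)%R -> (0 < T)%R -> (0 < k)%R ->
  limf_esup (fun eta : R => ereal_sup [set P [set w |
      (T / eta)%:E < hitting_time (chain eta x) (~` (Icov e `\` A e)) w]
    | x in Icov e] / (gamma eta * T / eta)%:E) (0%R : R)^'+ = 0 ->
  \forall eta \near (0%R : R)^'+, forall y, Icov e y ->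
    (fine (P (pathwise (chain eta) (stay_then (Icov e `\` A e) (Num.truncn (T / eta))
       (Icov e `\` A e)) y)) <= gamma eta * T / eta * k)%R.
Proof.
move=> e0 T0 k0 hsup; have [mJ JI] := Jf e0; have [mA AI] := Af e0.
have near0 : \forall eta \near (0%R : R)^'+, (0 < eta)%R by exact: nbhs_right_gt.
have nearsup : \forall eta \near (0%R : R)^'+, ereal_sup [set P [set w |
      (T / eta)%:E < hitting_time (chain eta x) (~` (Icov e `\` A e)) w]
    | x in Icov e] / (gamma eta * T / eta)%:E < k%:E.
  by apply: limf_esup_lt_near; rewrite hsup lte_fin.
near=> eta => y Jy.
have eta0 : (0 < eta)%R by near: eta.
have [K hK] := chain_markov eta0.
have Teta : (0 <= T / eta)%R by rewrite divr_ge0// ltW.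
have norm0 : (0 < gamma eta * T / eta)%R by rewrite divr_gt0// mulr_gt0// gamma_gt0.
have mJA : measurable (Icov e `\` A e : set (Borel S)) by exact: measurableD.
rewrite -lee_fin fine_probabilityK; last first.
  by apply: (measurable_pathwise y); exact: (has_markov_property_stay_then hK).
rewrite -(stay_event (chain eta) y (Icov e `\` A e) Teta).
suff : ereal_sup [set P [set w |
      (T / eta)%:E < hitting_time (chain eta x) (~` (Icov e `\` A e)) w]
    | x in Icov e] / (gamma eta * T / eta)%:E < k%:E.
  by move/(ereal_sup_div_lt norm0); apply; exists y.
by near: eta.
Unshelve. all: by end_near. Qed.

(** The order of choices matters: first [e'], small for the sets [B], [setT] and [I] at once and
    with [Icov e] inside [Icov e']; then [T0]; then [T], large with respect to [T0]; finally
    [eta]. *)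
Lemma renewal_estimates_near (e k c : R) (B : set S) : (0 < e)%R ->
  (0 < k < 1)%R -> measurable (B : set (Borel S)) -> C (~` I) = c%:E ->
  exists (J A' : set S) (T0 T : R),
    [/\ [/\ (0 < T0)%R, (0 < T)%R & (T0 <= k * T)%R],
        measurable (J : set (Borel S)) /\ J `<=` I,
        measurable (A' : set (Borel S)) /\ A' `<=` I,
        Icov e `<=` J
      & \forall eta \near (0%R : R)^'+,
        renewal_estimates P (chain eta) I J A' B (Num.truncn (T / eta))
          (Num.truncn (T0 / eta)) (gamma eta * T / eta) k c
          (fine (C (interior B)) - k) (fine (C (closure B)) + k)].
Proof.
move=> e0 /andP[k0 k1] mB Cc.
have CT : C setT = c%:E by rewrite (locationT).
have CTfin : C setT \is a fin_num by rewrite CT.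
have [_ _ _ atom] := hatom.
have [dB [eB [TB [dB0 eB0 TB0 limB HB]]]] := atom _ mB.
have [dS [eS [TS [dS0 eS0 TS0 limS HS]]]] := atom _ mT.
have [dI [eI [TI [dI0 eI0 TI0 limI HI]]]] := atom _ hI.
have hcov' : \forall e' \near (0%R : R)^'+, Icov e `<=` Icov e'.
  by have [_ _ H] := hcov; exact: H.
have limB' := iterated_lim0_near limB k0.
have limS' := iterated_lim0_near limS k0.
have limI' := iterated_lim0_near limI k0.
have [e' [e'0 e'B e'S e'I [ee' [MB HMB] [MS HMS] [MI HMI]]]] : exists e',
    [/\ (0 < e')%R, (e' <= eB)%R, (e' <= eS)%R, (e' <= eI)%R &
     [/\ Icov e `<=` Icov e', exists M, forall T, (M < T)%R -> (dB e' T < k)%R,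
      exists M, forall T, (M < T)%R -> (dS e' T < k)%R &
      exists M, forall T, (M < T)%R -> (dI e' T < k)%R]].
  apply: (@filter_ex _ ((0%R : R)^'+)); near=> e'; split.
  - by near: e'; exact: nbhs_right_gt.
  - by near: e'; exact: nbhs_right_le.
  - by near: e'; exact: nbhs_right_le.
  - by near: e'; exact: nbhs_right_le.
  - by split; near: e'.
pose T0 := TS e'; have T00 : (0 < T0)%R by exact: TS0.
have TBp := TB0 _ e'0; have TIp := TI0 _ e'0.
have [T [Tp kT sT]] := exists_horizon T0 [:: MB; MS; MI; TB e'; TS e'; TI e'] k0.
have gtT M : M \in [:: MB; MS; MI; TB e'; TS e'; TI e'] -> (M < T)%R by exact: sT.
have [MBT MST MIT] : [/\ (MB < T)%R, (MS < T)%R & (MI < T)%R].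
  by split; apply: gtT; rewrite !inE eqxx ?orbT.
have [TBT TST TIT] : [/\ (TB e' < T)%R, (TS e' < T)%R & (TI e' < T)%R].
  by split; apply: gtT; rewrite !inE eqxx ?orbT.
have TT0 : (T < T + T0)%R by rewrite ltrDl.
have [mJ JI] := Jf e'0; have [mA AI] := Af e'0.
have TT0p : (0 < T + T0)%R by rewrite addr_gt0.
have [[BL _ BU] _ _] := HB e' T e'0 e'B (ltW TBT).
have [[SL _ SU] _ _] := HS e' T e'0 e'S (ltW TST).
have [[SL' _ SU'] _ _] := HS e' (T + T0)%R e'0 e'S (ltW (lt_trans TST TT0)).
have [[IL _ IU] _ _] := HI e' T e'0 e'I (ltW TIT).
have [_ Sav Shit] := HS e' T0 e'0 e'S (lexx _).
have eBn := exit_near e'0 Tp mB (HMB T MBT) CTfin BL BU.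
have eSn := exit_near e'0 Tp mT (HMS T MST) CTfin SL SU.
(* The horizon [T + T0] covers a whole cycle. *)
have eSn' := exit_near e'0 TT0p mT (HMS _ (lt_trans MST TT0)) CTfin SL' SU'.
have eIn := exit_near e'0 Tp hI (HMI T MIT) CTfin IL IU.
have avn := avoid_near e'0 T00 k0 Sav.
have stn := start_ge_near e'0 T00 k0 Shit.
exists (Icov e'), (A e'), T0, T; split => //.
have near0 : \forall eta \near (0%R : R)^'+, (0 < eta)%R by exact: nbhs_right_gt.
have T0T : (T0 <= T)%R by apply: le_trans kT _; rewrite ler_piMl// ltW.
have nI : setI_closed ((0%R : R)^'+) by exact: filterI.
have near_all := nI _ _ near0 (nI _ _ eBn (nI _ _ eSn (nI _ _ eSn' (nI _ _ eIn (nI _ _ avn stn))))).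
apply: (filterS (F := (0%R : R)^'+) _ near_all) => eta [eta0 [EB [ES [ES' [EI [AV ST]]]]]].
have [K hK] := chain_markov eta0; have ge0 := gamma_gt0 eta0.
have rE T' : (gamma eta * T' / eta = gamma eta / eta * T')%R by rewrite mulrAC.
have ge : (0 < gamma eta / eta)%R by rewrite divr_gt0.
have ciT : fine (C (interior setT)) = c by rewrite interiorT CT.
have ccT : fine (C (closure setT)) = c by rewrite closureT CT.
have c0 : (0 <= c)%R by rewrite -lee_fin -Cc measure_ge0.
split.
- by move=> y /EB /andP[].
- by move=> y /EB /andP[].
- by move=> y /ES /andP[]; rewrite ciT.
- move=> y /ES' /andP[_]; rewrite ccT => ET.
  apply: (@le_trans _ _ (gamma eta * (T + T0) / eta * (c + k))%R).
    apply: le_trans ET; apply: le_fine_probability; [exact: (measurable_exits hK)..|].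
    (* Integer parts are superadditive, so [l + n] steps fit in the horizon [T + T0]; after that,
       [T + T0 <= (1 + k) * T]. *)
    move=> w; apply: exits_le; rewrite truncn_ge_nat; last by rewrite divr_ge0// ltW.
    rewrite natrD mulrDl; apply: lerD; rewrite truncn_le divr_ge0// ltW//.
  rewrite !rE [leRHS]mulrA; apply: ler_wpM2r; first by rewrite addr_ge0// ltW.
  by rewrite -[leRHS]mulrA ler_pM2l// mulrDr mulr1 lerD2l mulrC.
- by move=> y /EI /andP[_]; rewrite (location_closure0) add0r.
(* The estimate is normalised at the horizon [T0], and [T0 <= T]. *)
- move=> y /AV /le_trans; apply; rewrite !rE; apply: ler_wpM2r; first exact: ltW.
  by rewrite ler_pM2l.
- exact: ST.
Unshelve. all: by end_near. Qed.

(** * Bounds for small [eta] at a fixed error [k], and their limits *)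

Variables (e t c : R).
Hypotheses (e0 : (0 < e)%R) (t0 : (0 <= t)%R) (Cc : C (~` I) = c%:E).

Local Notation th := (cycle_loss c).

Let c0 : (0 <= c)%R. Proof. by rewrite -lee_fin -Cc measure_ge0. Qed.

Lemma rho_near T r : (0 < T)%R -> (0 < r)%R ->
  \forall eta \near (0%R : R)^'+, (gamma eta * T / eta <= r)%R.
Proof.
move=> Tp r0; have [_ _ gcvg _] := hatom.
have rT : (0 < r / T)%R by rewrite divr_gt0.
have : \forall eta \near (0%R : R)^'+, (gamma eta / eta < r / T)%R by exact: (cvgr_lt 0%R).
by apply: filterS => eta /ltW; rewrite mulrAC ler_pdivlMr.
Qed.

Lemma late_hit_upper_near (B : set S) k : c = 1%R -> (0 < k)%R -> (2 * k < 1)%R ->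
  measurable (B : set (Borel S)) -> B `<=` ~` I ->
  \forall eta \near (0%R : R)^'+, forall y, Icov e y ->
    (fine (P (pathwise (chain eta) (late_hit I (Num.truncn (t / gamma eta)) B) y)) <=
     upper_bound_fun (fine (C (closure B))) t k)%R.
Proof.
move=> c1 k0 k1 mB BI; have kk : (0 < k < 1)%R by rewrite k0; move: k0 k1; lra.
have [J [A' [T0 [T [[T00 Tp T0T] [mJ JI] [mA AI] eJ est]]]]] :=
  renewal_estimates_near e0 kk mB Cc.
have nI : setI_closed ((0%R : R)^'+) by exact: filterI.
have near0 : \forall eta \near (0%R : R)^'+, (0 < eta)%R by exact: nbhs_right_gt.
have nearT : \forall eta \near (0%R : R)^'+, (eta <= T)%R by exact: nbhs_right_le.
have near_rho := rho_near Tp (divr_gt0 k0 (ltr0n R 4)).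
apply: (filterS (F := (0%R : R)^'+) _ (nI _ _ near0 (nI _ _ nearT (nI _ _ near_rho est)))).
move=> eta [eta0 [etaT [rhok re]]] y /eJ Jy.
have [K hK] := chain_markov eta0.
apply: (late_hit_upper hK hI mJ mA mB JI eta0 T00 (gamma_gt0 eta0) t0 k0 k1 Tp T0T re) => //.
by rewrite mulrC -ler_pdivlMr.
Qed.

Let lower_side_near T k : (0 < T)%R -> (0 < k)%R ->
  \forall eta \near (0%R : R)^'+, [/\ (0 < eta)%R, (eta <= k * T)%R,
    (gamma eta * T / eta <= k)%R & (gamma eta * T / eta * th k * (1 + k) <= k)%R].
Proof.
move=> Tp k0; have thk : (0 < th k * (1 + k))%R.
  apply: mulr_gt0; last exact: addr_gt0.
  by apply: ltr_wpDl => //; apply: mulr_ge0; apply: addr_ge0 => //; exact: ltW.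
have near_rho := rho_near Tp (divr_gt0 k0 thk).
have near_rho' := rho_near Tp k0.
near=> eta; split.
- by near: eta; exact: nbhs_right_gt.
- by near: eta; apply: nbhs_right_le; rewrite mulr_gt0.
- by near: eta.
- by rewrite -mulrA -ler_pdivlMr//; near: eta.
Unshelve. all: by end_near. Qed.

Lemma late_hit_lower_near (B : set S) k : (0 < k)%R -> (2 * k < 1)%R ->
  measurable (B : set (Borel S)) -> B `<=` ~` I ->
  \forall eta \near (0%R : R)^'+, forall y, Icov e y ->
    (lower_bound_fun th t k * ((fine (C (interior B)) - k) / th k) <=
      fine (P (pathwise (chain eta) (late_hit I (Num.truncn (t / gamma eta)) B) y)))%R.
Proof.
move=> k0 k1 mB BI; have kk : (0 < k < 1)%R by rewrite k0; move: k0 k1; lra.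
have [J [A' [T0 [T [[T00 Tp T0T] [mJ JI] [mA AI] eJ est]]]]] :=
  renewal_estimates_near e0 kk mB Cc.
have nI : setI_closed ((0%R : R)^'+) by exact: filterI.
apply: (filterS (F := (0%R : R)^'+) _ (nI _ _ (lower_side_near Tp k0) est)).
move=> eta [[eta0 etaT rhok rth] re] y /eJ Jy.
have [K hK] := chain_markov eta0.
(* If [C (interior B)] is below [k], the claimed lower bound is not positive and there is nothing to
   prove. *)
have [bl0|bl0] := leP 0%R (fine (C (interior B)) - k)%R.
  exact: (late_hit_lower hK hI mJ mA mB JI AI eta0 (gamma_gt0 eta0) t0 k0 k1 Tp re).
apply: le_trans (fine_probability_ge0 _ _); apply: mulr_ge0_le0.
  by apply: mulr_ge0; [exact: expR_ge0|move: k1; lra].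
apply: mulr_le0_ge0; first exact: ltW.
rewrite invr_ge0; apply: addr_ge0; last exact: ltW.
by apply: mulr_ge0; apply: addr_ge0 => //; exact: ltW.
Qed.

Lemma stay_lower_near k : (0 < k)%R -> (2 * k < 1)%R ->
  \forall eta \near (0%R : R)^'+, forall y, Icov e y ->
    (lower_bound_fun th t k <=
      fine (P (pathwise (chain eta) (stay_then I (Num.truncn (t / gamma eta)) I) y)))%R.
Proof.
move=> k0 k1; have kk : (0 < k < 1)%R by rewrite k0; move: k0 k1; lra.
have [J [A' [T0 [T [[T00 Tp T0T] [mJ JI] [mA AI] eJ est]]]]] :=
  renewal_estimates_near e0 kk hI Cc.
have nI : setI_closed ((0%R : R)^'+) by exact: filterI.
apply: (filterS (F := (0%R : R)^'+) _ (nI _ _ (lower_side_near Tp k0) est)).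
move=> eta [[eta0 etaT rhok rth] re] y /eJ Jy.
have [K hK] := chain_markov eta0.
exact: (stay_lower hK hI mJ mA JI AI eta0 (gamma_gt0 eta0) t0 k0 k1 Tp re).
Qed.

Let continuous_th : {for 0%R, continuous th}.
Proof.
rewrite /continuous_at /cycle_loss.
apply: cvgD; last exact: cvg_id.
by apply: cvgM; apply: cvgD; [exact: cvg_cst|exact: cvg_id|exact: cvg_cst|exact: cvg_id].
Qed.

Let th0 : th 0%R = c.
Proof. by rewrite /cycle_loss !addr0 mul1r. Qed.

(** [k] is fixed first, with [upper_bound_fun] within [eps] of its limit at 0; only then is [eta]
    taken small. *)
Lemma late_hit_upper_limit (B : set S) eps : c = 1%R -> (0 < eps)%R ->
  measurable (B : set (Borel S)) -> B `<=` ~` I ->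
  \forall eta \near (0%R : R)^'+, forall y, Icov e y ->
    (fine (P (pathwise (chain eta) (late_hit I (Num.truncn (t / gamma eta)) B) y)) <=
     fine (C (closure B)) * expR (- t) + eps)%R.
Proof.
move=> c1 eps0 mB BI.
have [k [k0 k1]] := cvg_small (@cvg_upper_bound R (fine (C (closure B))) t) eps0.
rewrite ler_norml => /andP[bk _].
apply: filterS (late_hit_upper_near c1 k0 k1 mB BI) => eta H y /H /le_trans; apply.
by move: bk; lra.
Qed.

Lemma late_hit_lower_limit (B : set S) eps : c = 1%R -> (0 < eps)%R ->
  measurable (B : set (Borel S)) -> B `<=` ~` I ->
  \forall eta \near (0%R : R)^'+, forall y, Icov e y ->
    (fine (C (interior B)) * expR (- t) - eps <=
      fine (P (pathwise (chain eta) (late_hit I (Num.truncn (t / gamma eta)) B) y)))%R.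
Proof.
move=> c1 eps0 mB BI; set b := fine _.
have th_neq0 : th 0%R != 0%R by rewrite th0 c1 oner_neq0.
have cth : th k @[k --> (0%R : R)^'+] --> th 0%R.
  by apply: cvg_at_right_filter; exact: continuous_th.
have clim : (lower_bound_fun th t k * ((b - k) / th k) @[k --> (0%R : R)^'+] -->
    (expR (- (th 0%R * t)) * ((b - 0) / th 0%R) : R))%R.
  apply: cvgM; first by apply: cvg_lower_bound; exact: continuous_th.
  apply: cvgM; last exact: cvgV.
  by apply: cvg_at_right_filter; apply: cvgB; [exact: cvg_cst|exact: cvg_id].
rewrite th0 c1 mul1r subr0 divr1 in clim.
have [k [k0 k1]] := cvg_small clim eps0.
rewrite ler_norml => /andP[_ bk].
apply: filterS (late_hit_lower_near k0 k1 mB BI) => eta H y /H; apply: le_trans.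
by rewrite -/b [(b * expR _)%R]mulrC; move: bk; rewrite c1; lra.
Qed.

(** With [c = 0] the loss of a cycle vanishes with [k], so the exponent tends to 0 for every [t] and
    the bound to 1. *)
Lemma stay_lower_limit eps : c = 0%R -> (0 < eps)%R ->
  \forall eta \near (0%R : R)^'+, forall y, Icov e y ->
    (1 - eps <=
      fine (P (pathwise (chain eta) (stay_then I (Num.truncn (t / gamma eta)) I) y)))%R.
Proof.
move=> c00 eps0.
have clim := @cvg_lower_bound R th t continuous_th.
rewrite th0 c00 mul0r oppr0 expR0 in clim.
have [k [k0 k1]] := cvg_small clim eps0.
rewrite ler_norml => /andP[_ bk].
apply: filterS (stay_lower_near k0 k1) => eta H y /H; apply: le_trans.
by move: bk; rewrite c00; lra.
Qed.

End asymptotic_atom_bounds.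

(** * The law of the exit time and of the exit location *)

Unset Implicit Arguments.
Set Strict Implicit.

Theorem theorem2p11 (R : realType) (S : pmetricType R)
    (d : measure_display) (Omega : measurableType d)
    (P : probability Omega R) (V : R -> nat -> S -> Omega -> S)
    (I : set S) (C : {measure set (Borel S) -> \bar R})
    (gamma : R -> R) (Icov A : R -> set S)
    (hV : markov_family P V)
    (hI : measurable (I : set (Borel S)))
    (hC : location_measure I C)
    (hcov : covering I Icov)
    (hattr : asymptotic_domain_of_attraction P V I Icov)
    (hatom : asymptotic_atom P V I C gamma Icov A) :
  let tau eta x w := hitting_time (fun j => V eta j x) (~` I) w in
  (C (~` I) = 1 ->
    forall (e : R) (B : set (Borel S)) (t : R),
      (0 < e)%R -> Icov e !=set0 -> measurable B -> B `<=` ~` I -> (0 <= t)%R ->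
      let exit_in eta x :=
        P ([set w | t%:E < (gamma eta)%:E * tau eta x w] `&`
           hit_location_in (fun j => V eta j x) (~` I) B) in
      [/\ C (interior B) * (expR (- t))%:E <=
            limf_einf (fun eta : R =>
              ereal_inf [set exit_in eta x | x in Icov e]) (0%R : R)^'+,
          limf_einf (fun eta : R =>
            ereal_inf [set exit_in eta x | x in Icov e]) (0%R : R)^'+ <=
            limf_esup (fun eta : R =>
              ereal_sup [set exit_in eta x | x in Icov e]) (0%R : R)^'+
        & limf_esup (fun eta : R =>
            ereal_sup [set exit_in eta x | x in Icov e]) (0%R : R)^'+ <=
            C (closure B) * (expR (- t))%:E])
  /\
  (C (~` I) = 0 ->
    forall e t : R, (0 < e)%R -> Icov e !=set0 -> (0 < t)%R ->
      ereal_sup [set P [set w | (gamma eta)%:E * tau eta x w <= t%:E]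
                | x in Icov e] @[eta --> (0%R : R)^'+] --> 0).
Proof.
move=> tau; split => [CI1 e B t e0 [x0 Jx0] mB BI t0 exit_in|CI0 e t e0 [x0 Jx0] t0].
  have near0 : \forall eta \near (0%R : R)^'+, (0 < eta)%R by exact: nbhs_right_gt.
  have nI : setI_closed ((0%R : R)^'+) by exact: filterI.
  have CT1 : C setT = 1%R%:E by rewrite (locationT hI hC).
  have Cf (D : set S) : measurable (D : set (Borel S)) -> C D = (fine (C D))%:E.
    move=> mD; rewrite fineK// ge0_fin_numE ?measure_ge0//.
    apply: le_lt_trans (_ : C setT < +oo); last by rewrite CT1 ltry.
    by apply: le_measure; rewrite ?inE.
  have exitE eta x : (0 < eta)%R -> exit_in eta x = (fine (P (pathwise
      (fun x j => V eta j x) (late_hit I (Num.truncn (t / gamma eta)) B) x)))%:E.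
    move=> eta0; have [K hK] := chain_markov hV eta0.
    rewrite fine_probabilityK; last first.
      by apply: (measurable_pathwise x); exact: (has_markov_property_late_hit hK).
    rewrite -(late_hit_event (fun x j => V eta j x) x (gamma_gt0 hatom eta0) t0 BI).
    by [].
  split.
  - rewrite (Cf _ (borel_interior B)) -EFinM; apply/lee_subgt0Pr => eps eps0.
    rewrite -EFinB; apply: limf_einf_ge_near.
    apply: (filterS (F := (0%R : R)^'+) _ (nI _ _ near0
      (late_hit_lower_limit hV hI hC hcov hattr hatom e0 t0 CI1 erefl eps0 mB BI))).
    move=> eta [eta0 H] /=; apply: le_ereal_inf_tmp => _ [x Jx <-].
    by rewrite exitE// lee_fin; exact: H.
  - apply: limf_einf_le_esup; apply: filterS near0 => eta eta0 /=.
    (* A point of [Icov e] places the infimum below the supremum. *)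
    apply: (@le_trans _ _ (exit_in eta x0)).
      by apply: ereal_inf_lbound; exists x0.
    by apply: ereal_sup_ubound; exists x0.
  - rewrite (Cf _ (borel_closure B)) -EFinM; apply/lee_addgt0Pr => eps eps0.
    rewrite -EFinD; apply: limf_esup_le_near.
    apply: (filterS (F := (0%R : R)^'+) _ (nI _ _ near0
      (late_hit_upper_limit hV hI hC hcov hattr hatom e0 t0 CI1 erefl eps0 mB BI))).
    move=> eta [eta0 H] /=; apply: ge_ereal_sup => _ [x Jx <-].
    by rewrite exitE// lee_fin; exact: H.
have near0 : \forall eta \near (0%R : R)^'+, (0 < eta)%R by exact: nbhs_right_gt.
have nI : setI_closed ((0%R : R)^'+) by exact: filterI.
pose f eta := ereal_sup [set P [set w | (gamma eta)%:E * tau eta x w <= t%:E] | x in Icov e].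
have f_bound eps : (0 < eps)%R ->
    \forall eta \near (0%R : R)^'+, 0 <= f eta <= eps%:E.
  move=> eps0; apply: (filterS (F := (0%R : R)^'+) _ (nI _ _ near0
    (stay_lower_limit hV hI hC hcov hattr hatom e0 (ltW t0) CI0 erefl eps0))).
  move=> eta [eta0 H] /=; have [K hK] := chain_markov hV eta0.
  apply/andP; split.
    by apply: le_trans (measure_ge0 P _) (ereal_sup_ubound _); exists x0.
  apply: ge_ereal_sup => _ [x Jx <-].
  have mS : measurable (pathwise (fun x j => V eta j x)
      (stay_then I (Num.truncn (t / gamma eta)) I) x).
    by apply: (measurable_pathwise x); exact: (has_markov_property_stay_then hK).
  rewrite (scaled_hitting_time_le (fun x j => V eta j x) x I (gamma_gt0 hatom eta0) (ltW t0)).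
  rewrite probability_setC// -[P _]fine_probabilityK// -EFinB lee_fin.
  by have := H x Jx; lra.
apply/fine_cvgP; split.
  apply: filterS (f_bound _ ltr01) => eta /andP[f0 f1].
  by rewrite ge0_fin_numE//; apply: le_lt_trans f1 (ltry _).
apply/cvgrPdist_le => eps eps0; apply: filterS (f_bound _ eps0) => eta /andP[f0 f1].
rewrite /= sub0r normrN ger0_norm ?fine_ge0//.
rewrite -lee_fin fineK// ge0_fin_numE//; apply: le_lt_trans f1 (ltry _).
Qed.
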